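(* Let $\lambda$ be a Young diagram with $n$ boxes, and let $H$ be the reciprocal of its Cauchy transform. For any integers $l\geq 1$ and $k_1,\dots,k_l\geq 1$, $$(-1)^l k_1 \cdots k_l\, \Sigma_{k_1,\dots,k_l}= [z_1^{-1}] \cdots [z_l^{-1}] \Bigg[ \left(\prod_{1\leq r\leq l} H(z_r) H(z_r-1)\cdots H(z_r-k_r+1) \right) \prod_{1\leq s<t\leq l}\frac{(z_s-z_t)(z_s-z_t+k_t-k_s)}{(z_s-z_t-k_s)(z_s-z_t+k_t)} \Bigg].$$ The right-hand side is understood as follows: the expression in brackets is expanded as a power series in decreasing powers of $z_l$, with coefficients being functions of $z_1,\dots,z_{l-1}$, and the coefficient of $z_l^{-1}$ is selected; then this procedure is repeated with respect to $z_{l-1}$, $z_{l-2}$, \dots, $z_1$.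
   Context: Cauchy transform of a Young diagram: the content of the box in row $i$ and column $j$ is $j-i$. For a Young diagram $\lambda$ let $x_1<\cdots<x_s$ be the contents of the boxes that can be added to $\lambda$ (so that the result is a Young diagram) and $y_1<\cdots<y_{s-1}$ the contents of the boxes that can be removed from $\lambda$ (equivalently, the local minima, respectively maxima, of the profile of $\lambda$ drawn in the Russian convention; e.g. for $\lambda=(4,3,1)$ these are $(-3,-1,2,4)$ and $(-2,1,3)$). Put $$G(z)=\frac{(z-y_1)\cdots(z-y_{s-1})}{(z-x_1)\cdots(z-x_s)},\qquad H(z)=\frac{1}{G(z)}.$$ Normalized characters: for integers $k_1,\dots,k_l\geq 1$, $$\Sigma_{k_1,\dots,k_l}=\frac{\operatorname{Tr}\rho^{\lambda}(k_1,\dots,k_l,1^{n-k_1-\cdots-k_l})}{\operatorname{Tr}\rho^{\lambda}(e)}\;(n)_{k_1+\cdots+k_l},$$ where $\rho^\lambda$ is the irreducible representation of $S_n$ indexed by $\lambda$, the argument denotes any permutation in $S_n$ of that cycle type, and $(n)_k=n(n-1)\cdots(n-k+1)$. By convention $\Sigma_{k_1,\dots,k_l}=0$ whenever $k_1+\cdots+k_l>n$. *)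

(* Defs.v *)
From HB Require Import structures.
From mathcomp Require Import all_boot all_order all_algebra.
From mathcomp Require Import all_fingroup all_solvable all_field all_character.
From mathcomp Require Import zify.

Set Implicit Arguments.
Unset Strict Implicit.
Unset Printing Implicit Defensive.

Import Order.TTheory GRing.Theory Num.Theory.
Local Open Scope ring_scope.

(* A Young diagram is given by its row lengths [:: lam_0; lam_1; ...], all
   positive; rows and columns are numbered from 0, which does not affect the
   contents. *)
Definition is_young_diagram (n : nat) (lam : seq nat) : bool :=
  [&& sorted geq lam, 0%N \notin lam & sumn lam == n].

(* Adding (removing) the box at the end of row i leaves the row lengths
   nonincreasing; after a removal the last row may have become empty. *)
Definition addable_row (lam : seq nat) (i : nat) : bool :=
  sorted geq (incr_nth lam i).

Definition removable_row (lam : seq nat) (i : nat) : bool :=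
  (0 < nth 0 lam i)%N && sorted geq (set_nth 0%N lam i (nth 0 lam i).-1).

Definition content (i j : nat) : int := j%:Z - i%:Z.

Definition addable_contents (lam : seq nat) : seq int :=
  [seq content i (nth 0%N lam i) | i <- iota 0 (size lam).+1
                                 & addable_row lam i].

Definition removable_contents (lam : seq nat) : seq int :=
  [seq content i (nth 0%N lam i).-1 | i <- iota 0 (size lam)
                                    & removable_row lam i].

Definition cauchyG (F : fieldType) (lam : seq nat) (z : F) : F :=
  (\prod_(y <- removable_contents lam) (z - y%:~R)) /
  (\prod_(x <- addable_contents lam) (z - x%:~R)).

Definition cauchyH (F : fieldType) (lam : seq nat) (z : F) : F :=
  (cauchyG lam z)^-1.

(* The boxes of lam are numbered 0, ..., n - 1 row by row: box m lies in row
   reshape_index lam m and column reshape_offset lam m. *)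
Definition row_stab (n : nat) (lam : seq nat) : {set 'S_n} :=
  [set p : 'S_n | [forall m, reshape_index lam (p m) == reshape_index lam m]].

Definition col_stab (n : nat) (lam : seq nat) : {set 'S_n} :=
  [set q : 'S_n | [forall m, reshape_offset lam (q m) == reshape_offset lam m]].

(* The group algebra of S_n is the space of row vectors on which the regular
   representation acts by right multiplication; delta_mx 0 (gring_index _ g)
   is the basis vector g. *)
Definition young_symmetrizer (n : nat) (lam : seq nat)
    : 'rV[algC]_#|[set: 'S_n]| :=
  \sum_(p in row_stab n lam) \sum_(q in col_stab n lam)
    (-1) ^+ q *: delta_mx 0 (gring_index [set: 'S_n]%G (p * q)%g).

(* The irreducible representation of S_n indexed by lam, realised on the right
   ideal generated by its Young symmetrizer. *)
Definition specht_repr (n : nat) (lam : seq nat) :=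
  submod_repr (cyclic_mx_module (regular_repr algC [set: 'S_n]%G)
                                (young_symmetrizer n lam)).

(* The permutation s has cycle type (k_1, ..., k_l, 1, ..., 1). *)
Definition has_cycle_type (n l : nat) (k : 'I_l -> nat) (s : 'S_n) : bool :=
  perm_eq [seq #|pred_of_set C| | C <- enum (porbits s)]
          ([seq k i | i <- enum 'I_l] ++ nseq (n - \sum_(i < l) k i) 1%N).

(* Sigma_{k_1, ..., k_l}, computed with the permutation s, which is meant to
   have cycle type (k_1, ..., k_l, 1, ..., 1) when k_1 + ... + k_l <= n. *)
Definition normalized_character (n : nat) (lam : seq nat)
    (l : nat) (k : 'I_l -> nat) (s : 'S_n) : algC :=
  if (n < \sum_(i < l) k i)%N then 0 else
  \tr (specht_repr n lam s) / \tr (specht_repr n lam 1%g)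
    * (n ^_ (\sum_(i < l) k i))%:R.

Notation "x %:F" := (@FracField.tofrac _ x) : ring_scope.

(* a is the sequence of coefficients of the expansion
     f = \sum_(m <= N) a_m z^m
   in decreasing powers of the variable z: a vanishes for large indices, and
   if f = p / q then the product of q with this series is p. *)
Definition is_expansion (K : fieldType) (f : {fraction {poly K}})
    (a : int -> K) : Prop :=
  (exists N : int, forall m : int, N < m -> a m = 0) /\
  (forall p q : {poly K}, q != 0 -> f = p%:F / q%:F ->
    forall m : int, \sum_(i < size q) q`_i * a (m - i%:Z) =
                    if m is Posz j then p`_j else 0).

Section Expansion.
Variable K : fieldType.
Implicit Types (p q : {poly K}) (a b : int -> K).

Let cv q a (m : int) : K := \sum_(i < size q) q`_i * a (m - i%:Z).

Let cvE q a m N : (size q <= N)%N -> cv q a m = \sum_(i < N) q`_i * a (m - i%:Z).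
Proof.
move=> leN; rewrite /cv (big_ord_widen N (fun i => q`_i * a (m - i%:Z))) //.
rewrite big_mkcond; apply: eq_bigr => i _; case: ltnP => // le_i.
by rewrite nth_default ?mul0r.
Qed.

Let cvD p q a m : cv (p + q) a m = cv p a m + cv q a m.
Proof.
pose N := maxn (size p) (size q).
rewrite !(@cvE _ _ _ N) ?leq_maxl ?leq_maxr ?size_polyD // -big_split /=.
by apply: eq_bigr => i _; rewrite coefD mulrDl.
Qed.

Let cvC c a m : cv c%:P a m = c * a m.
Proof. by rewrite (@cvE _ _ _ 1) ?size_polyC_leq1 // big_ord1 coefC subr0. Qed.

Let cvMX p a m : cv (p * 'X) a m = cv p a (m - 1).
Proof.
rewrite (@cvE _ _ _ (size p).+1); last first.
  by apply: leq_trans (size_polyMleq _ _) _; rewrite size_polyX addn2.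
rewrite big_ord_recl coefMX mul0r add0r /cv; apply: eq_bigr => i _.
by rewrite lift0 coefMX /=; congr (_ * a _); lia.
Qed.

Let cvM p q a m : cv (p * q) a m = cv p (cv q a) m.
Proof.
elim/poly_ind: p m => [|p c IHp] m.
  by rewrite mul0r /cv size_poly0 !big_ord0.
rewrite mulrDl cvD -mulrA (mulrC 'X) mulrA cvMX IHp cvD cvMX cvC; congr (_ + _).
rewrite mul_polyC (@cvE _ _ _ (size q)) ?size_scale_leq // /cv mulr_sumr.
by apply: eq_bigr => i _; rewrite coefZ mulrA.
Qed.

Let bounded a := exists N : int, forall m : int, N < m -> a m = 0.

Let cv_inj q a b : q != 0 -> bounded a -> bounded b ->
  cv q a =1 cv q b -> a =1 b.
Proof.
move=> q0 [N1 ha] [N2 hb] eq_ab m.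
have [M hM] : exists M : int, forall m, M < m -> a m = b m.
  by exists (Num.max N1 N2) => x; rewrite gt_max => /andP[? ?]; rewrite ha ?hb.
have: forall j : nat, forall m, M < m + j%:Z -> a m = b m.
  elim=> [|j IHj] x hx; first by apply: hM; rewrite addr0 in hx.
  have sz : size q = (size q).-1.+1 by rewrite prednK // size_poly_gt0.
  have := eq_ab (x + (size q).-1%:Z).
  rewrite !(@cvE _ _ _ (size q).-1.+1) -?sz // sz !big_ord_recr /= addrK.
  rewrite (eq_bigr (fun i : 'I__ => q`_i * b (x + (size q).-1%:Z - i%:Z))).
    by move/addrI/mulfI; apply; rewrite -/(lead_coef q) lead_coef_eq0.
  by move=> i _; rewrite IHj //; have := ltn_ord i; lia.
by move/(_ (`|M - m|%N.+1)); apply; lia.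
Qed.

Lemma fraction_repr (f : {fraction {poly K}}) :
  {pq : {poly K} * {poly K} | pq.2 != 0 & f = pq.1%:F / pq.2%:F}.
Proof.
pose x := generic_quotient.repr f; exists (\n_x, \d_x) => /=; first exact: denom_ratioP.
have d0 : (\d_x)%:F != 0 :> {fraction {poly K}}.
  by rewrite tofrac_eq0 denom_ratioP.
apply: (mulIf d0); rewrite divfK // -[f]generic_quotient.reprK -/x.
change (FracField.mul (\pi_{fraction {poly K}} x)%qT (\d_x)%:F = (\n_x)%:F).
rewrite !piE; apply/eqP; rewrite piE /FracField.mulf /=.
rewrite FracField.equivfE !numden_Ratio ?mulf_neq0 ?denom_ratioP ?oner_eq0 //.
by rewrite !mulr1 mulrC.
Qed.

Lemma is_expansion_unique (f : {fraction {poly K}}) a b :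
  is_expansion f a -> is_expansion f b -> a =1 b.
Proof.
move=> [ba ha] [bb hb]; have [[p q] /= q0 fE] := fraction_repr f.
by apply: (cv_inj q0 ba bb) => m; rewrite /cv (ha p q) // (hb p q).
Qed.

Let divMX p q j u : q != 0 -> ((p * 'X^j) %/ q)`_(u + j) = (p %/ q)`_u.
Proof.
move=> q0; rewrite {1}(divp_eq p q) mulrDl mulrAC divpD mulpK //.
rewrite coefD coefMXn ltnNge leq_addl addnK /=.
rewrite [X in _ + X]nth_default ?addr0 //.
have [->|r0] := eqVneq (p %% q) 0; first by rewrite mul0r div0p size_poly0.
rewrite size_divp // size_mulXn //; have := ltn_modpN0 p q0.
move: (size q) (size (p %% q)) => d e; lia.
Qed.

Let divMX_gen p q i j u v : q != 0 -> (u + j = v + i)%N ->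
  ((p * 'X^i) %/ q)`_u = ((p * 'X^j) %/ q)`_v.
Proof.
move=> q0 uj; rewrite -(divMX (p * 'X^i) j u q0) -(divMX (p * 'X^j) i v q0).
by rewrite -!mulrA -!exprD uj (addnC i).
Qed.

Lemma expansion_exists (f : {fraction {poly K}}) :
  {a : int -> K | is_expansion f a}.
Proof.
have [[p0 q0] /= q0n fE] := fraction_repr f.
pose a (m : int) := ((p0 * 'X^(`|m|%N)) %/ q0)`_(absz (m + (absz m)%:Z)).
have aE (m : int) (N : nat) : 0 <= m + N%:Z ->
    a m = ((p0 * 'X^N) %/ q0)`_(absz (m + N%:Z)).
  by move=> mN; apply: divMX_gen => //; lia.
have ba : bounded a.
  exists (size p0)%:Z => m hm; rewrite (aE _ 0%N); last by lia.
  rewrite expr0 mulr1 nth_default // size_divp //.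
  by move: (size q0) (size p0) hm => d e; lia.
have ha m : cv q0 a m = if m is Posz j then p0`_j else 0.
  have [N leN] : exists N, (`|m| + size q0 <= N)%N by exists (`|m| + size q0)%N.
  have mN : 0 <= m + N%:Z by lia.
  have -> : cv q0 a m = (p0 * 'X^N)`_(absz (m + N%:Z)).
    rewrite (divp_eq (p0 * 'X^N) q0) coefD [X in _ + X]nth_default; last first.
      apply: leq_trans (ltnW (ltn_modpN0 (p0 * 'X^N) q0n)) _.
      by move: (size q0) leN => d leN; lia.
    rewrite addr0 mulrC coefM (@cvE _ _ _ (absz (m + N%:Z)).+1); last first.
      by move: (size q0) leN => d leN; lia.
    apply: eq_bigr => i _; congr (_ * _).
    rewrite (aE _ N); last by have := ltn_ord i; lia.
    by congr (_`_ _); have := ltn_ord i; lia.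
  rewrite coefMXn; case: m leN mN => j leN mN.
    by rewrite ifF; [congr (_`_ _)|]; lia.
  by rewrite ifT //; lia.
have ext b c r : b =1 c -> cv r b =1 cv r c.
  by move=> bc m; apply: eq_bigr => i _; rewrite bc.
exists a; split=> // p q qn fE' m; rewrite -/(cv q a m).
pose b (m : int) : K := if m is Posz j then p`_j else 0.
apply: (cv_inj q0n _ _ _ m : cv q a m = b m).
- have [N hN] := ba; exists (N + (size q)%:Z) => x hx.
  rewrite /cv big1 // => i _; rewrite hN ?mulr0 //.
  by have := ltn_ord i; lia.
- exists (size p)%:Z => -[j|j] hj //=; rewrite nth_default //.
  by move: (size p) hj => d hj; lia.
have Posz_cv (r : {poly K}) : (fun m : int => if m is Posz j then r`_j else 0)
    =1 cv r (fun m => (m == 0)%:R).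
  move=> x; rewrite /cv; case: x => j.
    have [lt|le] := ltnP j (size r); last first.
      rewrite nth_default // big1 // => i _.
      by rewrite (_ : _ == _ = false) ?mulr0 //; have := ltn_ord i; lia.
    rewrite (bigD1 (Ordinal lt)) //= subrr eqxx mulr1 big1 ?addr0 // => i ne.
    rewrite (_ : _ == _ = false) ?mulr0 //.
    by move: ne; rewrite -val_eqE /=; lia.
  by rewrite big1 // => i _; rewrite (_ : _ == _ = false) ?mulr0 //; lia.
have pq : q0 * p = q * p0.
  have num (u v : {poly K}) : v != 0 -> f = u%:F / v%:F -> u%:F = f * v%:F.
    by move=> v0 ->; rewrite divfK // tofrac_eq0.
  apply/eqP; rewrite -tofrac_eq 2!tofracM (num _ _ qn fE') (num _ _ q0n fE).
  by rewrite [X in X == _]mulrCA [X in _ == X]mulrCA [q0%:F * _]mulrC.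
move=> x; rewrite -cvM mulrC cvM (ext _ _ _ ha) (ext _ _ _ (Posz_cv p0)).
by rewrite -cvM -pq cvM; apply: ext => y; rewrite -Posz_cv.
Qed.

End Expansion.

Definition expansion (K : fieldType) (f : {fraction {poly K}}) : int -> K :=
  sval (expansion_exists f).

(* The field of rational functions in z_1, ..., z_l, as rational functions in
   z_l over the field of rational functions in z_1, ..., z_(l-1). *)
Fixpoint ratfun (l : nat) : fieldType :=
  if l is l'.+1 then {fraction {poly ratfun l'}} else algC.

(* zvar i is the variable z_(i+1). *)
Fixpoint zvar (l : nat) : 'I_l -> ratfun l :=
  if l is l'.+1 return 'I_l -> ratfun l then
    fun i => if unlift ord_max i is Some j then (zvar j)%:P%:F
             else ('X : {poly ratfun l'})%:F
  else fun=> 0.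

(* [z_1^{-1}] ... [z_l^{-1}], the coefficient in z_l being taken first. *)
Fixpoint iter_residue (l : nat) : ratfun l -> algC :=
  if l is l'.+1 return ratfun l -> algC then
    fun f => iter_residue (expansion f (-1))
  else id.

(* Main.v *)
(* Put m = size lam and mu_i = lam_i + m - 1 - i.  Then, with w = z + m,
   H(z) H(z-1) ... H(z-k+1) = (w)_k \prod_i (w - mu_i - k) / (w - mu_i), and the
   double product is exactly the factor by which these expressions change when
   mu_i is lowered.  Taking residues at w_l = mu_i therefore gives a recursion on
   l, in which mu is replaced by mu - k_l e_i; the residues at the remaining poles
   cancel.

   On the other side, Frobenius' formula says that the character of the Specht
   module at a permutation of cycle type (k_1, ..., k_l, 1, ...) is the coefficient
   of x^mu in the Vandermonde determinant times a product of power sums, and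
   expanding the power sums gives the same recursion.  To prove Frobenius' formula
   for the module generated by the Young symmetrizer e, let chi be its character
   and omega the Frobenius class function.  The trace of left multiplication by e
   shows that chi has norm 1 and that <chi, omega> is proportional to omega(e);
   evaluating the latter combinatorially gives <chi, omega> = 1, and omega has
   norm 1 by a sign-reversing argument, so that |chi - omega|^2 = 1 - 2 + 1 = 0. *)

Require Import Defs.
From mathcomp Require Import all_boot all_order all_algebra.
From mathcomp Require Import all_fingroup all_solvable all_field all_character.
From mathcomp Require Import zify ring.

Set Implicit Arguments.
Unset Strict Implicit.
Unset Printing Implicit Defensive.

Import Order.TTheory GRing.Theory Num.Theory.
Local Open Scope ring_scope.

(** * Residues at infinity *)

(** Two obstacles shape the proof. First, e e = c e holds for some integer c that is not known to be
    nonzero at the outset. The character is therefore handled as c chi ([young_class_sum]), all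
    pairings stay integers, and c <> 0 is read off at the end from the value n! at the identity.
    Second, lowering an entry of mu need not give the shifted rows of a diagram: entries may collide
    or become negative. Nothing is reordered; mu is an arbitrary integer vector, and on degenerate
    vectors the terms of both recursions vanish. The recursions are matched by Frobenius' dimension
    formula, because [strip_coef] is the factor by which dimension / size! changes. The norm of
    omega is, in coefficients, Cauchy's determinant det (1 / (1 - x_i y_j)), obtained from Newton's
    relation n h_n = sum_k p_k h_(n-k). *)

Section ExpansionTheory.
Variable K : fieldType.
Implicit Types (f g : {fraction {poly K}}) (p q : {poly K}).

Lemma expansionP f : is_expansion f (expansion f).
Proof. exact: svalP. Qed.

(** Descending induction from the range where [a] vanishes: at index [m + deg q] the leading
    coefficient of [q] multiplies [a m], and all other terms have higher indices. *)
Lemma convolution_eq0 q (a : int -> K) (M : int) : q != 0 ->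
  (exists N : int, forall m, N < m -> a m = 0) ->
  (forall m, M + (size q).-1%:Z <= m -> \sum_(i < size q) q`_i * a (m - i%:Z) = 0) ->
  forall m, M <= m -> a m = 0.
Proof.
move=> q0 [N hN] h.
have: forall j : nat, forall m, N < m + j%:Z -> M <= m -> a m = 0.
  elim=> [|j IHj] x hx hM; first by apply: hN; rewrite addr0 in hx.
  have sz : size q = (size q).-1.+1 by rewrite prednK // size_poly_gt0.
  have := h (x + (size q).-1%:Z); rewrite sz big_ord_recr /= addrK big1 ?add0r.
    move=> e; have /eqP := e (lerD hM (lexx _)).
    by rewrite mulf_eq0 -/(lead_coef q) lead_coef_eq0 (negPf q0) => /eqP.
  by move=> i _; rewrite IHj ?mulr0 //; have := ltn_ord i; lia.
by move=> H m hm; apply: (H (`|N - m|%N.+1)) => //; lia.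
Qed.

Lemma expansion_conv p q m : q != 0 ->
  \sum_(i < size q) q`_i * expansion (p%:F / q%:F) (m - i%:Z) =
  if m is Posz j then p`_j else 0.
Proof. by move=> q0; have [_ /(_ p q q0 erefl)] := expansionP (p%:F / q%:F). Qed.

Lemma expansion_bounded f :
  exists N : int, forall m : int, N < m -> expansion f m = 0.
Proof. by case: (expansionP f). Qed.

Lemma expansionD f g m : expansion (f + g) m = expansion f m + expansion g m.
Proof.
have [[p q] /= q0 fE] := fraction_repr f.
have [[p' q'] /= q0' gE] := fraction_repr g.
have fE2 : f = (p * q')%:F / (q * q')%:F.
  rewrite fE !tofracM invfM mulrACA divff ?mulr1 // ?tofrac_eq0 //.
have gE2 : g = (p' * q)%:F / (q * q')%:F.
  by rewrite gE !tofracM invfM (mulrC _ q%:F) mulrACA divff ?mul1r // ?tofrac_eq0.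
have q2 : q * q' != 0 by rewrite mulf_neq0.
pose a m := expansion (f + g) m - expansion f m - expansion g m.
suff: a m = 0 by rewrite /a => /eqP; rewrite -addrA -opprD subr_eq0 => /eqP.
apply: (@convolution_eq0 (q * q') a m q2 _ _ m) => //.
  have [[N1 h1] [N2 h2]] := (expansion_bounded f, expansion_bounded g).
  have [N3 h3] := expansion_bounded (f + g).
  by exists (Num.max N1 (Num.max N2 N3)) => x; rewrite !gt_max => /and3P[? ? ?];
    rewrite /a h1 ?h2 ?h3 // !subr0.
move=> x _; under eq_bigr do rewrite !mulrBr.
rewrite !sumrB fE2 gE2 -mulrDl -tofracD !expansion_conv //.
case: x => j; last by rewrite !subr0.
by rewrite coefD addrAC addrK subrr.
Qed.

Lemma expansionZ c f m : expansion (c%:P%:F * f) m = c * expansion f m.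
Proof.
have [[p q] /= q0 fE] := fraction_repr f.
pose a m := expansion (c%:P%:F * f) m - c * expansion f m.
suff: a m = 0 by rewrite /a => /eqP; rewrite subr_eq0 => /eqP.
apply: (@convolution_eq0 q a m q0 _ _ m) => //.
  have [[N1 h1] [N2 h2]] := (expansion_bounded f, expansion_bounded (c%:P%:F * f)).
  by exists (Num.max N1 N2) => x; rewrite !gt_max => /andP[? ?];
    rewrite /a h1 ?h2 // mulr0 subrr.
move=> x _; under eq_bigr do rewrite mulrBr mulrCA.
rewrite sumrB -mulr_sumr fE mulrA -tofracM !expansion_conv //.
by case: x => // j; rewrite ?mulr0 ?subrr // mul_polyC coefZ subrr.
Qed.

(** A proper fraction has no coefficient at indices >= 0, so in the convolution at index [deg q - 1]
    only the leading coefficient of [q] times the coefficient at -1 survives. *)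
Lemma expansion_proper p q : (size p < size q)%N ->
  expansion (p%:F / q%:F) (-1) = p`_(size q).-2 / lead_coef q.
Proof.
move=> lt; have q0 : q != 0 by rewrite -size_poly_gt0; case: (size q) lt.
have a0 : forall m, 0 <= m -> expansion (p%:F / q%:F) m = 0.
  apply: (@convolution_eq0 q _ 0 q0); first exact: expansion_bounded.
  move=> [] m hm; rewrite expansion_conv // nth_default //.
  by move: (size q) (size p) lt hm => d e; lia.
have := @expansion_conv p q ((size q).-1%:Z - 1) q0.
have sz : size q = (size q).-1.+1 by rewrite prednK // size_poly_gt0.
rewrite sz big_ord_recr /= big1 ?add0r; last first.
  by move=> i _; rewrite a0 ?mulr0 //; have := ltn_ord i; lia.
rewrite addrAC subrr add0r -/(lead_coef q) => e.
apply: (mulfI (_ : lead_coef q != 0)); rewrite ?lead_coef_eq0 // e mulrC.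
rewrite divfK ?lead_coef_eq0 //.
move: sz lt; case: (size q) => [|[|d]] // _ lt /=.
  by rewrite [RHS]nth_default // -ltnS.
by rewrite subn1.
Qed.

Lemma expansion_poly p : expansion p%:F (-1) = 0.
Proof.
have := @expansion_conv p 1 (-1) (oner_neq0 _).
by rewrite size_poly1 big_ord1 coefC mul1r subr0 tofrac1 divr1.
Qed.

(* Lagrange interpolation of the numerator at the (simple) poles. *)
Lemma residue_simple_poles (I : finType) (a : I -> K) p : injective a ->
  expansion (p%:F / (\prod_i ('X - (a i)%:P))%:F) (-1) =
  \sum_i p.[a i] / \prod_(j | j != i) (a i - a j).
Proof.
move=> a_inj; set q := \prod_i _.
pose c i := p.[a i] / \prod_(j | j != i) (a i - a j).
pose Q i := \prod_(j | j != i) ('X - (a j)%:P).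
pose r := \sum_i c i *: Q i.
have q0 : q != 0 by apply/prodf_neq0 => i _; rewrite polyXsubC_eq0.
have Qa i j : (Q i).[a j] = if i == j then \prod_(j | j != i) (a i - a j) else 0.
  rewrite /Q horner_prod; case: eqP => [->|/eqP ne].
    by apply: eq_bigr => k _; rewrite hornerXsubC.
  by rewrite (bigD1 j) 1?eq_sym //= hornerXsubC subrr mul0r.
have n0 i : \prod_(j | j != i) (a i - a j) != 0.
  by apply/prodf_neq0 => j ne; rewrite subr_eq0 (inj_eq a_inj) eq_sym.
have ra i : r.[a i] = p.[a i].
  rewrite /r horner_sum (bigD1 i) //= hornerZ Qa eqxx divfK // big1 ?addr0 //.
  by move=> j ne; rewrite hornerZ Qa (negPf ne) mulr0.
(* [p - r] vanishes at every pole, so p/q and r/q differ by a polynomial, which has no coefficient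
   at -1. *)
have dv : (q %| p - r)%R.
  have -> : q = \prod_(x <- [seq a i | i <- enum I]) ('X - x%:P).
    by rewrite big_map big_enum.
  apply: uniq_roots_dvdp.
    by apply/allP => _ /mapP[i _ ->]; rewrite /root hornerD hornerN ra subrr.
  by rewrite uniq_rootsE map_inj_uniq // enum_uniq.
have -> : p%:F / q%:F = ((p - r) %/ q)%:F + r%:F / q%:F.
  have e := divpK dv; rewrite -{1}(addrNK r p) tofracD mulrDl -{1}e.
  by rewrite tofracM mulfK ?tofrac_eq0.
have szq : size q = #|I|.+1.
  have -> : q = \prod_(x <- [seq a i | i <- enum I]) ('X - x%:P).
    by rewrite big_map big_enum.
  by rewrite size_prod_XsubC size_map -cardE.
have mQ i : Q i \is monic by apply: monic_prod => j _; apply: monicXsubC.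
have szQ i : size (Q i) = #|I|.
  have : size ((Q i) * ('X - (a i)%:P)) = #|I|.+1.
    by rewrite -szq /q (bigD1 i) //= mulrC.
  rewrite size_Mmonic ?monicXsubC ?monic_neq0 // size_XsubC addn2 /=.
  by case.
rewrite expansionD expansion_poly add0r expansion_proper; last first.
  rewrite szq ltnS; apply: leq_trans (size_sum _ _ _) _.
  by apply/bigmax_leqP => i _; rewrite -(szQ i) size_scale_leq.
have -> : lead_coef q = 1.
  by apply/eqP/monic_prod => j _; apply: monicXsubC.
rewrite divr1 szq /= coef_sum; apply: eq_bigr => i _.
have /monicP := mQ i; rewrite coefZ /lead_coef szQ => ->; exact: mulr1.
Qed.

End ExpansionTheory.

(** * The factors of the integrand *)

Definition single_factor (K : fieldType) m (mu : 'I_m -> int) (k : nat) (z : K) : K :=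
  \prod_(j < k) (z - j%:R) *
  \prod_(i < m) ((z - (mu i)%:~R - k%:R) / (z - (mu i)%:~R)).

Definition pair_factor (K : fieldType) (z : K) (k : nat) (w : K) (j : nat) : K :=
  (z - w) * (z - w + j%:R - k%:R) / ((z - w - k%:R) * (z - w + j%:R)).

Definition full_product (K : fieldType) m (mu : 'I_m -> int) l (k : 'I_l -> nat)
    (z : 'I_l -> K) : K :=
  (\prod_r single_factor mu (k r) (z r)) *
  \prod_(r < l) \prod_(t < l | (r < t)%N) pair_factor (z r) (k r) (z t) (k t).

(** The residue of [single_factor mu k] at [mu i], divided by [- k]. *)
Definition strip_coef (K : fieldType) m (mu : 'I_m -> int) (k : nat) (i : 'I_m) : K :=
  \prod_(j < k) ((mu i)%:~R - j%:R) *
  \prod_(j | j != i) (((mu i)%:~R - (mu j)%:~R - k%:R) / ((mu i)%:~R - (mu j)%:~R)).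

(** Integer values, no sorting: entries may collide or become negative, and the antisymmetry of
    [alt_delta] accounts for the order. *)
Definition lower m (mu : 'I_m -> int) (k : nat) (i : 'I_m) : 'I_m -> int :=
  fun j => if j == i then mu j - k%:Z else mu j.

Definition upd (T : Type) l (f : 'I_l -> T) (s : 'I_l) (x : T) : 'I_l -> T :=
  fun r => if r == s then x else f r.

Section OneStep.
Variable K : fieldType.
Variables (m : nat) (mu : 'I_m -> int).

Lemma pair_factorC (z : K) k w j : pair_factor z k w j = pair_factor w j z k.
Proof.
rewrite /pair_factor; congr (_ / _); last by ring.
by ring.
Qed.

(** Isolates the index [s]: by symmetry it does not matter whether [s] is the smaller or the larger
    member of a pair. *)
Lemma prod_lt_pairs l (s : 'I_l) (e : 'I_l -> 'I_l -> K) :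
  (forall r t, e r t = e t r) ->
  \prod_(r < l) \prod_(t < l | (r < t)%N) e r t =
  \prod_(r | r != s) e r s *
    \prod_(r < l | r != s) \prod_(t < l | (r < t)%N && (t != s)) e r t.
Proof.
move=> eC; rewrite (bigD1 s) //=.
have -> : \prod_(r < l | r != s) \prod_(t < l | (r < t)%N) e r t =
   \prod_(r | r != s) ((if (r < s)%N then e r s else 1) *
      \prod_(t < l | (r < t)%N && (t != s)) e r t).
  apply: eq_bigr => r ne; case: ifP => lt.
    by rewrite (bigD1 s).
  rewrite mul1r; apply: eq_bigl => t; case: eqP => [->|]; rewrite ?andbT ?andbF //.
rewrite big_split /= mulrA; congr (_ * _).
rewrite -[X in _ * X]big_mkcondr /= [RHS](bigID (fun r : 'I_l => (s < r)%N)) /=.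
congr (_ * _).
  under eq_bigr do rewrite eC; apply: eq_bigl => t.
  by rewrite -val_eqE /=; case: ltngtP.
by apply: eq_bigl => t; rewrite -val_eqE /=; case: ltngtP.
Qed.

(** Two chains of consecutive arguments, of lengths [k] and [j], join into one: the numerators of
    the first chain are the denominators of the second. *)
Lemma single_factor_merge (z : K) k j : (forall x : int, z - x%:~R != 0) ->
  single_factor mu k z * single_factor mu j (z - k%:R) = single_factor mu (k + j) z.
Proof.
move=> gz; rewrite /single_factor mulrACA; congr (_ * _).
  rewrite big_split_ord; congr (_ * _); apply: eq_bigr => i _ /=.
  by rewrite natrD opprD addrA.
rewrite -big_split; apply: eq_bigr => i _ /=.
have h1 := gz (mu i).
have h2 : z - (mu i)%:~R - k%:R != 0.
  by have := gz (mu i + k%:Z); rewrite intrD opprD addrA.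
have -> : z - k%:R - (mu i)%:~R = z - (mu i)%:~R - k%:R by ring.
by rewrite natrD; field; rewrite h1 h2.
Qed.

Lemma pair_factor_merge (z w : K) k j j' : (forall x : int, z - w - x%:~R != 0) ->
  pair_factor z k w j * pair_factor z k (w - j%:R) j' = pair_factor z k w (j + j').
Proof.
move=> gz; rewrite /pair_factor.
have h1 : z - w - k%:R != 0 := gz k%:Z.
have h2 : z - w + j%:R != 0 by have := gz (- j%:Z); rewrite intrN opprK.
have h3 : z - w + j%:R - k%:R != 0.
  by have := gz (k%:Z - j%:Z); rewrite intrB opprB addrA.
have h4 : z - w + j%:R + j'%:R != 0.
  by have := gz (- (j + j')%:Z); rewrite intrN opprK -[_%:~R]/(_%:R) natrD addrA.
have e : z - (w - j%:R) = z - w + j%:R by ring.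
rewrite e natrD !addrA; field.
by rewrite h1 h2 h4 h3.
Qed.

(* pair_factor is the change of single_factor when one row is lowered by j. *)
Lemma single_factor_lower (z : K) k j i : (forall x : int, z - x%:~R != 0) ->
  single_factor mu k z * pair_factor z k (mu i)%:~R j = single_factor (lower mu j i) k z.
Proof.
move=> gz; rewrite /single_factor -mulrA; congr (_ * _).
rewrite (bigD1 i) // [RHS](bigD1 i) //= mulrAC; congr (_ * _); last first.
  by apply: eq_bigr => t ne; rewrite /lower (negPf ne).
rewrite /lower eqxx /pair_factor intrB.
have h1 := gz (mu i).
have h2 : z - (mu i)%:~R - k%:R != 0.
  by have := gz (mu i + k%:Z); rewrite intrD opprD addrA.
have h3 : z - (mu i)%:~R + j%:R != 0.
  by have := gz (mu i - j%:Z); rewrite intrB opprB addrA addrAC.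
have -> : z - ((mu i)%:~R - j%:R) = z - (mu i)%:~R + j%:R by ring.
by field; rewrite h1 h2 h3.
Qed.

Definition generic l (z : 'I_l -> K) :=
  (forall r (x : int), z r - x%:~R != 0) /\
  (forall r t (x : int), r != t -> z r - z t - x%:~R != 0).

Lemma full_product_lower l (k : 'I_l -> nat) (z : 'I_l -> K) j i : generic z ->
  full_product mu k z * \prod_r pair_factor (z r) (k r) (mu i)%:~R j =
  full_product (lower mu j i) k z.
Proof.
move=> [gz _]; rewrite /full_product mulrAC -big_split; congr (_ * _).
by apply: eq_bigr => r _ /=; rewrite single_factor_lower.
Qed.

Lemma full_productD1 l (k : 'I_l -> nat) (z : 'I_l -> K) s :
  full_product mu k z =
  single_factor mu (k s) (z s) *
  (\prod_(r | r != s) pair_factor (z r) (k r) (z s) (k s)) *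
  ((\prod_(r | r != s) single_factor mu (k r) (z r)) *
   \prod_(r < l | r != s) \prod_(t < l | (r < t)%N && (t != s))
       pair_factor (z r) (k r) (z t) (k t)).
Proof.
rewrite /full_product (bigD1 s) //= (@prod_lt_pairs _ s) => [|r t].
  by rewrite mulrACA.
by rewrite pair_factorC.
Qed.

(** The situation at the pole [z s - k s]: the chain of the eliminated variable continues the chain
    of [z s] downwards. *)
Lemma full_product_merge l (k : 'I_l -> nat) (z : 'I_l -> K) s j : generic z ->
  full_product mu k z * (single_factor mu j (z s - (k s)%:R) *
    \prod_(r | r != s) pair_factor (z r) (k r) (z s - (k s)%:R) j) =
  full_product mu (upd k s (k s + j)%N) z.
Proof.
move=> [g1 g2]; rewrite !(full_productD1 _ _ s) mulrAC; congr (_ * (_ * _)).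
- rewrite /upd eqxx mulrACA single_factor_merge //; congr (_ * _).
  rewrite -big_split; apply: eq_bigr => r ne /=; rewrite (negPf ne).
  by rewrite pair_factor_merge // => x; apply: g2.
- by apply: eq_bigr => r ne; rewrite /upd (negPf ne).
- apply: eq_bigr => r ne; apply: eq_bigr => t /andP[_ ne'].
  by rewrite /upd (negPf ne) (negPf ne').
Qed.

(** The situation at the pole [z s + j]: the chain of the eliminated variable ends just above [z s],
    so the joined chain starts at [z s + j]. *)
Lemma full_product_merge_shift l (k : 'I_l -> nat) (z : 'I_l -> K) s j : generic z ->
  full_product mu k z * (single_factor mu j (z s + j%:R) *
    \prod_(r | r != s) pair_factor (z r) (k r) (z s + j%:R) j) =
  full_product mu (upd k s (k s + j)%N) (upd z s (z s + j%:R)).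
Proof.
move=> [g1 g2]; rewrite !(full_productD1 _ _ s) mulrAC; congr (_ * (_ * _)).
- have g3 (x : int) : z s + j%:R - x%:~R != 0.
    by have := g1 s (x - j%:Z); rewrite intrB opprB addrA.
  rewrite /upd eqxx mulrACA addnC -single_factor_merge // addrK; congr (_ * _).
    by rewrite mulrC.
  rewrite -big_split; apply: eq_bigr => r ne /=; rewrite (negPf ne).
  rewrite -pair_factor_merge ?addrK 1?mulrC // => x.
  have := g2 r s (x + j%:Z) ne; rewrite intrD.
  by rewrite !opprD !addrA [_ - x%:~R - _]addrAC.
- by apply: eq_bigr => r ne; rewrite /upd (negPf ne).
- apply: eq_bigr => r ne; apply: eq_bigr => t /andP[_ ne'].
  by rewrite /upd (negPf ne) (negPf ne').
Qed.

End OneStep.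

Section ResidueStep.
Variable K : fieldType.
Variables (m : nat) (mu : 'I_m -> int).
Variables (l : nat) (k : 'I_l -> nat) (z : 'I_l -> K) (k0 : nat) (c0 : K).

Let poleset : finType := ('I_m + ('I_l + 'I_l))%type.

Let pole (x : poleset) : K :=
  match x with
  | inl i => (mu i)%:~R
  | inr (inl r) => z r - (k r)%:R
  | inr (inr r) => z r + k0%:R
  end.

Let num (w : K) : K :=
  \prod_(j < k0) (w - j%:R) * \prod_i (w - (mu i)%:~R - k0%:R) *
  \prod_r ((z r - w) * (z r - w + k0%:R - (k r)%:R)).

Let residue_at x : K := num (pole x) / \prod_(y | y != x) (pole x - pole y).

Let prod_poles (w : K) (P : pred poleset) :
  \prod_(y | P y) (w - pole y) =
  \prod_(i | P (inl i)) (w - (mu i)%:~R) *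
  (\prod_(r | P (inr (inl r))) (w - (z r - (k r)%:R)) *
   \prod_(r | P (inr (inr r))) (w - (z r + k0%:R))).
Proof. by rewrite big_sumType big_sumType. Qed.

Let pairE (w : K) (r : 'I_l) :
  ((z r - w) * (z r - w + k0%:R - (k r)%:R)) /
  ((w - (z r - (k r)%:R)) * (w - (z r + k0%:R))) = pair_factor (z r) (k r) w k0.
Proof. by rewrite /pair_factor; congr (_ / _); ring. Qed.

Let prod_pairE (w : K) (P : pred 'I_l) :
  \prod_(r | P r) pair_factor (z r) (k r) w k0 =
  \prod_(r | P r) ((z r - w) * (z r - w + k0%:R - (k r)%:R)) /
  (\prod_(r | P r) (w - (z r - (k r)%:R)) * \prod_(r | P r) (w - (z r + k0%:R))).
Proof. by rewrite -big_split -prodf_div /=; apply: eq_bigr => r _; rewrite pairE. Qed.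

Let residue_row i : residue_at (inl i) = - k0%:R * strip_coef K mu k0 i *
  \prod_r pair_factor (z r) (k r) (mu i)%:~R k0.
Proof.
rewrite /residue_at prod_poles /= -big_split /= /num invfM mulrACA -prodf_div /=.
congr (_ * _); last by apply: eq_bigr => r _; rewrite pairE.
rewrite (bigD1 i) //= /strip_coef prodf_div subrr add0r.
rewrite (eq_bigl (fun j => j != i)) => [|j]; last by [].
by ring.
Qed.

(** At both poles attached to [s] the numerator factors of [s] give [k s * k0]; the difference to
    the companion pole is [- (k s + k0)] here and [k s + k0] in [residue_above]. This opposite sign
    is what makes the two residues cancel later. *)
Let residue_below s : (k s + k0)%:R != 0 :> K ->
  residue_at (inr (inl s)) = - ((k s)%:R * k0%:R / (k s + k0)%:R) *
  (single_factor mu k0 (z s - (k s)%:R) *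
   \prod_(r | r != s) pair_factor (z r) (k r) (z s - (k s)%:R) k0).
Proof.
move=> nz; rewrite /residue_at prod_poles /= /num.
rewrite [X in _ / (_ * (X * _))](eq_bigl (fun r => r != s)) => [|j]; last by [].
rewrite [X in _ * X / _ = _](bigD1 s) //= [X in _ / (_ * (_ * X)) = _](bigD1 s) //=.
rewrite prod_pairE [X in _ = _ * (X * _)]/single_factor prodf_div.
set w := z s - (k s)%:R.
have -> : (z s - w) * (z s - w + k0%:R - (k s)%:R) = (k s)%:R * k0%:R by rewrite /w; ring.
have -> : w - (z s + k0%:R) = - (k s + k0)%:R by rewrite natrD /w; ring.
rewrite !invfM invrN; ring.
Qed.

Let residue_above s : (k s + k0)%:R != 0 :> K ->
  residue_at (inr (inr s)) = (k s)%:R * k0%:R / (k s + k0)%:R *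
  (single_factor mu k0 (z s + k0%:R) *
   \prod_(r | r != s) pair_factor (z r) (k r) (z s + k0%:R) k0).
Proof.
move=> nz; rewrite /residue_at prod_poles /= /num.
rewrite [X in _ / (_ * (_ * X))](eq_bigl (fun r => r != s)) => [|j]; last by [].
rewrite [X in _ * X / _ = _](bigD1 s) //= [X in _ / (_ * (X * _)) = _](bigD1 s) //=.
rewrite prod_pairE [X in _ = _ * (X * _)]/single_factor prodf_div.
set w := z s + k0%:R.
have -> : (z s - w) * (z s - w + k0%:R - (k s)%:R) = (k s)%:R * k0%:R by rewrite /w; ring.
have -> : w - (z s - (k s)%:R) = (k s + k0)%:R by rewrite natrD /w; ring.
rewrite !invfM; ring.
Qed.

Let poleC (x : K) : {fraction {poly K}} := x%:P%:F.

(** A sum of residues at simple poles. Injectivity separates the row poles, genericity separates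
    poles of different origin, and [k s + k0 != 0] separates the two poles of one variable. *)
Lemma expansion_step :
  injective (fun i => (mu i)%:~R : K) -> generic z ->
  (forall s, (k s + k0)%:R != 0 :> K) ->
  expansion (single_factor mu k0 (('X : {poly K})%:F + poleC c0) *
     \prod_r pair_factor (poleC (z r)) (k r) (('X : {poly K})%:F + poleC c0) k0) (-1) =
  - k0%:R * \sum_i strip_coef K mu k0 i *
              \prod_r pair_factor (z r) (k r) (mu i)%:~R k0 +
  \sum_s (k s)%:R * k0%:R / (k s + k0)%:R *
    (single_factor mu k0 (z s + k0%:R) *
       \prod_(r | r != s) pair_factor (z r) (k r) (z s + k0%:R) k0 -
     single_factor mu k0 (z s - (k s)%:R) *
       \prod_(r | r != s) pair_factor (z r) (k r) (z s - (k s)%:R) k0).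
Proof.
move=> mu_inj [g1 g2] nz.
(* The expansion variable is the argument minus [c0]; translating all poles leaves the residues
   unchanged. *)
pose a x := pole x - c0.
have a_inj : injective a.
  move=> x y /addIr; case: x y => [i|[r|r]] [j|[t|t]] //= e.
  - by rewrite (mu_inj i j).
  - have := g1 t (mu i + (k t)%:Z).
    by rewrite intrD e subrK subrr eqxx.
  - have := g1 t (mu i - k0%:Z).
    by rewrite intrB e addrK subrr eqxx.
  - have := g1 r (mu j + (k r)%:Z).
    by rewrite intrD -e subrK subrr eqxx.
  - case: (r =P t) => [->//|/eqP ne]; have := g2 r t ((k r)%:Z - (k t)%:Z) ne.
    rewrite intrB -[(k r)%:~R]/((k r)%:R) -[(k t)%:~R]/((k t)%:R).
    rewrite (_ : _ - _ = (z r - (k r)%:R) - (z t - (k t)%:R)); last by ring.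
    by rewrite e subrr eqxx.
  - case: (r =P t) e => [<- e|/eqP ne e].
      have := nz r; rewrite natrD.
      rewrite (_ : _ + _ = (z r + k0%:R) - (z r - (k r)%:R)); last by ring.
      by rewrite e subrr eqxx.
    have := g2 r t ((k r)%:Z + k0%:Z) ne.
    rewrite intrD -[(k r)%:~R]/((k r)%:R) -[k0%:~R]/(k0%:R).
    rewrite (_ : _ - _ = (z r - (k r)%:R) - (z t + k0%:R)); last by ring.
    by rewrite e subrr eqxx.
  - have := g1 r (mu j - k0%:Z).
    by rewrite intrB -e addrK subrr eqxx.
  - case: (r =P t) e => [<- e|/eqP ne e].
      have := nz r; rewrite natrD.
      rewrite (_ : _ + _ = (z r + k0%:R) - (z r - (k r)%:R)); last by ring.
      by rewrite e subrr eqxx.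
    have := g2 r t (- ((k t)%:Z + k0%:Z)) ne.
    rewrite intrN intrD -[(k t)%:~R]/((k t)%:R) -[k0%:~R]/(k0%:R).
    rewrite (_ : _ - _ = (z r + k0%:R) - (z t - (k t)%:R)); last by ring.
    by rewrite e subrr eqxx.
  - case: (r =P t) => [->//|/eqP ne]; have := g2 r t 0 ne.
    by rewrite (addIr _ e) subrr subr0 eqxx.
have [X XE] : {X | X = ('X : {poly K}) + c0%:P} by eexists.
pose P : {poly K} := \prod_(j < k0) (X - j%:R) *
  \prod_i (X - (mu i)%:~R - k0%:R) *
  \prod_r (((z r)%:P - X) * ((z r)%:P - X + k0%:R - (k r)%:R)).
have PE x : P.[a x] = num (pole x).
  have hX : X.[a x] = pole x by rewrite XE hornerD hornerX hornerC subrK.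
  have hn (j : nat) : (j%:R : {poly K}).[a x] = j%:R by rewrite -polyC_natr hornerC.
  have hz (j : int) : (j%:~R : {poly K}).[a x] = j%:~R.
    by rewrite -(rmorph_int (@polyC K)) hornerC.
  rewrite /P !hornerM !horner_prod; congr (_ * _ * _); apply: eq_bigr => j _.
  - by rewrite hornerD hornerN hX hn.
  - by rewrite !hornerD !hornerN hX hn hz.
  - by rewrite hornerM !hornerD !hornerN hX !hn hornerC.
have -> : single_factor mu k0 (('X : {poly K})%:F + poleC c0) *
     \prod_r pair_factor (poleC (z r)) (k r) (('X : {poly K})%:F + poleC c0) k0 =
   P%:F / (\prod_x ('X - (a x)%:P))%:F.
  have fn (j : nat) : j%:R = (j%:R : {poly K})%:F :> {fraction {poly K}}.
    by rewrite rmorph_nat.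
  have fz (j : int) : j%:~R = (j%:~R : {poly K})%:F :> {fraction {poly K}}.
    by rewrite rmorph_int.
  have -> : ('X : {poly K})%:F + poleC c0 = X%:F by rewrite XE tofracD.
  have -> : \prod_x ('X - (a x)%:P) = \prod_i (X - (mu i)%:~R) *
     \prod_r (((z r)%:P - X - (k r)%:R) * ((z r)%:P - X + k0%:R)).
    rewrite !big_sumType /= -big_split; congr (_ * _); apply: eq_bigr => r _ /=.
      by rewrite /a XE /= polyCB (rmorph_int (@polyC K)); ring.
    by rewrite /a XE /= !(polyCB, polyCD, polyC_natr); ring.
  rewrite /P !tofracM invfM mulrACA !rmorph_prod /=; congr (_ * _).
    rewrite -mulrA -prodf_div; congr (_ * _); apply: eq_bigr => j _.
      by rewrite fn -tofracB.
    by rewrite fn fz -!tofracB.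
  rewrite -prodf_div; apply: eq_bigr => j _.
  by rewrite /pair_factor !fn !(tofracM, tofracB, tofracD).
rewrite residue_simple_poles //.
have aE x : \prod_(j | j != x) (a x - a j) = \prod_(j | j != x) (pole x - pole j).
  by apply: eq_bigr => j _; rewrite /a; ring.
rewrite (eq_bigr residue_at) => [|x _]; last by rewrite PE aE.
rewrite !big_sumType /= mulr_sumr; congr (_ + _).
  by apply: eq_bigr => i _; rewrite residue_row -mulrA.
rewrite -big_split; apply: eq_bigr => s _ /=.
by rewrite residue_below // residue_above // mulrBr mulNr addrC.
Qed.

End ResidueStep.

(** * Iterated residues in the field of rational functions *)

Fixpoint ratfun_const (l : nat) : {rmorphism algC -> ratfun l} :=
  if l is l'.+1 return {rmorphism algC -> ratfun l} then
    (@FracField.tofrac {poly ratfun l'}) \o (@polyC (ratfun l') \o ratfun_const l')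
  else idfun.

Lemma iter_residueD l (f g : ratfun l) :
  iter_residue (f + g) = iter_residue f + iter_residue g.
Proof. by elim: l f g => [|l IH] f g //=; rewrite expansionD IH. Qed.

Lemma iter_residueZ l c (f : ratfun l) :
  iter_residue (ratfun_const l c * f) = c * iter_residue f.
Proof. by elim: l f => [|l IH] f //=; rewrite expansionZ IH. Qed.

Lemma iter_residue0 l : iter_residue (0 : ratfun l) = 0.
Proof. by rewrite -(mul0r 0) -(rmorph0 (ratfun_const l)) iter_residueZ mul0r. Qed.

Lemma iter_residue_sum l (I : Type) (r : seq I) (P : pred I) (F : I -> ratfun l) :
  iter_residue (\sum_(i <- r | P i) F i) = \sum_(i <- r | P i) iter_residue (F i).
Proof.
by apply: (big_morph (@iter_residue l)) => [f g|]; rewrite ?iter_residueD ?iter_residue0.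
Qed.

Lemma ratfun_intr_eq0 l (x : int) : (x%:~R == 0 :> ratfun l) = (x == 0).
Proof. by rewrite -(rmorph_int (ratfun_const l)) fmorph_eq0 intr_eq0. Qed.

Lemma ratfun_natr_eq0 l (x : nat) : (x%:R == 0 :> ratfun l) = (x == 0%N).
Proof. exact: (ratfun_intr_eq0 l x%:Z). Qed.

Lemma zvar_lift l (r : 'I_l) :
  @zvar l.+1 (lift ord_max r) = (zvar r)%:P%:F :> {fraction {poly ratfun l}}.
Proof. by rewrite /= liftK. Qed.

Lemma zvar_max l :
  @zvar l.+1 ord_max = ('X : {poly ratfun l})%:F :> {fraction {poly ratfun l}}.
Proof. by rewrite /= unlift_none. Qed.

Lemma zvar_neq_int l (r : 'I_l) (x : int) : zvar r - x%:~R != 0.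
Proof.
elim: l r => [[]//|l IH] r.
case: (unliftP ord_max r) => [j|] ->.
  rewrite zvar_lift -(rmorph_int (@FracField.tofrac {poly ratfun l})) -tofracB.
  by rewrite -(rmorph_int (@polyC (ratfun l))) -polyCB tofrac_eq0 polyC_eq0.
rewrite zvar_max -(rmorph_int (@FracField.tofrac {poly ratfun l})) -tofracB.
by rewrite -(rmorph_int (@polyC (ratfun l))) tofrac_eq0 polyXsubC_eq0.
Qed.

Lemma zvarB_neq_int l (r t : 'I_l) (x : int) : r != t -> zvar r - zvar t - x%:~R != 0.
Proof.
elim: l r t => [[]//|l IH] r t.
case: (unliftP ord_max r) => [i|] ->; case: (unliftP ord_max t) => [j|] ->.
- rewrite (inj_eq lift_inj) => ne.
  rewrite 2!zvar_lift -(rmorph_int (@FracField.tofrac {poly ratfun l})) -!tofracB.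
  by rewrite -(rmorph_int (@polyC (ratfun l))) -!polyCB tofrac_eq0 polyC_eq0 IH.
- move=> _.
  rewrite zvar_lift zvar_max -(rmorph_int (@FracField.tofrac {poly ratfun l})) -!tofracB.
  rewrite -(rmorph_int (@polyC (ratfun l))) tofrac_eq0 addrAC -polyCB.
  by rewrite -opprB oppr_eq0 polyXsubC_eq0.
- move=> _.
  rewrite zvar_lift zvar_max -(rmorph_int (@FracField.tofrac {poly ratfun l})) -!tofracB.
  rewrite -(rmorph_int (@polyC (ratfun l))) tofrac_eq0 -addrA -opprD -polyCD.
  by rewrite polyXsubC_eq0.
- by rewrite eqxx.
Qed.

Lemma generic_zvar l (c : 'I_l -> int) : generic (fun r => zvar r + (c r)%:~R).
Proof.
split=> [r x|r t x ne].
  by have := zvar_neq_int r (x - c r); rewrite intrB opprB addrA addrAC.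
have := zvarB_neq_int (x - c r + c t) ne; rewrite !(intrD, intrN).
by congr (_ != 0); ring.
Qed.

(** The recursion left by the residues at the row poles. The last part comes first, as the
    coefficient in z_l is taken first. *)
Fixpoint strip_sum m l (mu : 'I_m -> int) : ('I_l -> nat) -> algC :=
  if l is l'.+1 return ('I_l -> nat) -> algC then
    fun k => \sum_i strip_coef algC mu (k ord_max) i *
               strip_sum (lower mu (k ord_max) i) (fun r => k (lift ord_max r))
  else fun=> 1.

Lemma strip_sumS m l (mu : 'I_m -> int) (k : 'I_l.+1 -> nat) :
  strip_sum mu k = \sum_i strip_coef algC mu (k ord_max) i *
    strip_sum (lower mu (k ord_max) i) (fun r => k (lift ord_max r)).
Proof. by []. Qed.

Lemma ratfun_const_strip l m (mu : 'I_m -> int) k i :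
  ratfun_const l (strip_coef algC mu k i) = strip_coef (ratfun l) mu k i.
Proof.
rewrite rmorphM !rmorph_prod; congr (_ * _); apply: eq_bigr => j _.
  by rewrite rmorphB rmorph_int rmorph_nat.
by rewrite fmorph_div !rmorphB !rmorph_int rmorph_nat.
Qed.

(** A collision means [mu j = mu i - k] for some other [j], and then the factor [mu i - mu j - k] is
    zero. *)
Lemma strip_coef_collision (K : fieldType) m (mu : 'I_m -> int) k i :
  injective mu -> ~ injective (lower mu k i) -> strip_coef K mu k i = 0.
Proof.
move=> mu_inj ninj.
have [j ne e] : exists2 j, j != i & mu j = mu i - k%:Z.
  case: (pickP (fun j => (j != i) && (mu j == mu i - k%:Z))) => [j /andP[ne /eqP e]|h].
    by exists j.
  case: ninj => a b; rewrite /lower.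
  case: (eqVneq a i) => [->|na]; case: (eqVneq b i) => [->|nb] // e.
  - by have := h b; rewrite nb -e eqxx.
  - by have := h a; rewrite na e eqxx.
  - exact: mu_inj.
rewrite /strip_coef [X in _ * X](bigD1 j) //= e intrB opprB addrCA subrr addr0.
by rewrite -[k%:~R]/(k%:R) subrr !mul0r mulr0.
Qed.

Lemma full_product_recr (K : fieldType) m (mu : 'I_m -> int) l (k : 'I_l.+1 -> nat)
    (z : 'I_l.+1 -> K) :
  full_product mu k z =
  full_product mu (fun r => k (lift ord_max r)) (fun r => z (lift ord_max r)) *
  (single_factor mu (k ord_max) (z ord_max) *
   \prod_r pair_factor (z (lift ord_max r)) (k (lift ord_max r)) (z ord_max) (k ord_max)).
Proof.
rewrite /full_product (bigD1_ord ord_max) //=.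
rewrite [X in _ * X = _](bigD1_ord ord_max) //= [X in _ * (X * _) = _]big1; last first.
  by move=> t; have := ltn_ord t; lia.
rewrite mul1r [X in _ * X = _](_ : _ = (\prod_(r < l) \prod_(t < l | (r < t)%N)
   pair_factor (z (lift ord_max r)) (k (lift ord_max r))
     (z (lift ord_max t)) (k (lift ord_max t))) * \prod_(r < l)
   pair_factor (z (lift ord_max r)) (k (lift ord_max r)) (z ord_max) (k ord_max)).
  by ring.
rewrite -big_split; apply: eq_bigr => r _ /=.
rewrite (bigD1_ord ord_max) /=; last by rewrite /bump; have := ltn_ord r; lia.
rewrite mulrC; congr (_ * _); apply: eq_bigl => t.
by rewrite /bump; have := ltn_ord r; have := ltn_ord t; lia.
Qed.

Lemma eq_full_product (K : fieldType) m (mu : 'I_m -> int) l (k k' : 'I_l -> nat)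
    (z z' : 'I_l -> K) :
  k =1 k' -> z =1 z' -> full_product mu k z = full_product mu k' z'.
Proof.
move=> ek ez; congr (_ * _); first by apply: eq_bigr => r _; rewrite ek ez.
by apply: eq_bigr => r _; apply: eq_bigr => t _; rewrite !ek !ez.
Qed.

Lemma rmorph_full_product (K K' : fieldType) (phi : {rmorphism K -> K'})
    m (mu : 'I_m -> int) l (k : 'I_l -> nat) (z : 'I_l -> K) :
  phi (full_product mu k z) = full_product mu k (fun r => phi (z r)).
Proof.
rewrite rmorphM !rmorph_prod; congr (_ * _); apply: eq_bigr => r _.
  rewrite rmorphM !rmorph_prod; congr (_ * _); apply: eq_bigr => j _.
    by rewrite rmorphB rmorph_nat.
  by rewrite fmorph_div !rmorphB rmorph_int rmorph_nat.
rewrite rmorph_prod; apply: eq_bigr => t _.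
by rewrite fmorph_div !(rmorphM, rmorphB, rmorphD, rmorph_nat).
Qed.

(* The independence of the shifts c makes the induction work: the residues at
   z_l = z_s - k_s and at z_l = z_s + k_l are opposite multiples of the same
   integrand with k_s replaced by k_s + k_l, up to a shift of z_s. *)
Theorem iter_residue_full_product m l (mu : 'I_m -> int) (k : 'I_l -> nat) (c : 'I_l -> int) :
  injective mu -> (forall r, (0 < k r)%N) ->
  iter_residue (full_product mu k (fun r => zvar r + (c r)%:~R)) =
  (-1) ^+ l * (\prod_r (k r)%:R) * strip_sum mu k.
Proof.
elim: l mu k c => [|l IH] mu k c mu_inj k_gt0.
  by rewrite /full_product !big_ord0 /= !mulr1.
set k0 := k ord_max; pose k' r := k (lift ord_max r).
pose c' r := c (lift ord_max r); pose Z r := zvar (r : 'I_l) + (c' r)%:~R.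
have gZ : generic Z by apply: generic_zvar.
have k'_gt0 r : (0 < k' r)%N by apply: k_gt0.
have nz j (s : 'I_l) : (k' s + j)%:R != 0 :> ratfun l.
  by rewrite ratfun_natr_eq0 addn_eq0 negb_and -lt0n k'_gt0.
pose phi : {rmorphism ratfun l -> {fraction {poly ratfun l}}} :=
  (@FracField.tofrac {poly ratfun l}) \o (@polyC (ratfun l)).
have zl r : zvar (lift ord_max r) + (c (lift ord_max r))%:~R = phi (Z r).
  by rewrite zvar_lift rmorphD rmorph_int.
have zm : zvar ord_max + (c ord_max)%:~R =
    ('X : {poly ratfun l})%:F + ((c ord_max)%:~R : ratfun l)%:P%:F.
  by rewrite zvar_max -[(_)%:P%:F]/(phi _) rmorph_int.
rewrite strip_sumS full_product_recr -/k0.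
rewrite (@eq_full_product _ _ _ _ _ k' _ (fun r => phi (Z r))) //.
rewrite -rmorph_full_product zm.
under eq_bigr do rewrite zl.
have muK_inj : injective (fun i => (mu i)%:~R : ratfun l).
  by move=> i j /eqP; rewrite -subr_eq0 -intrB ratfun_intr_eq0 subr_eq0 => /eqP/mu_inj.
rewrite [iter_residue _]/= expansionZ (expansion_step _ muK_inj gZ (nz k0)).
rewrite mulrDr mulrCA !mulr_sumr iter_residueD !iter_residue_sum.
rewrite [X in _ + X]big1 ?addr0 => [|s _]; last first.
  rewrite mulrCA mulrBr full_product_merge // full_product_merge_shift //.
  have -> : (k' s)%:R * k0%:R / (k' s + k0)%:R =
      ratfun_const l ((k' s)%:R * k0%:R / (k' s + k0)%:R).
    by rewrite fmorph_div rmorphM !rmorph_nat.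
  rewrite iter_residueZ; apply/eqP; rewrite mulf_eq0; apply/orP; right.
  rewrite -mulN1r -(rmorphN1 (ratfun_const l)) iter_residueD iter_residueZ mulN1r.
  have pos r : (0 < upd k' s (k' s + k0)%N r)%N.
    by rewrite /upd; case: ifP; rewrite // addn_gt0 k'_gt0.
  rewrite (@eq_full_product _ _ _ _ _ (upd k' s (k' s + k0)%N) _
     (fun r => zvar r + (upd c' s (c' s + k0%:Z) r)%:~R)) //.
    by rewrite !IH // subrr.
  by move=> r; rewrite /upd /Z; case: eqP => [->|//]; rewrite intrD addrA.
apply: eq_bigr => i _.
rewrite [full_product _ _ _ * _]mulrCA full_product_lower // mulrA.
rewrite -ratfun_const_strip -(rmorph_nat (ratfun_const l)) -rmorphN -rmorphM iter_residueZ.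
(* The induction hypothesis needs distinct entries; when lowering creates a repetition the
   coefficient is zero. *)
have [inj|/injectiveP ninj] := boolP (injectiveb (lower mu k0 i)).
  rewrite IH //; last exact/injectiveP.
  rewrite (bigD1_ord ord_max) //= exprS -/k0; ring.
by rewrite strip_coef_collision // ?mulr0 ?mul0r ?mulr0.
Qed.

(** * The reciprocal Cauchy transform of a Young diagram *)

Section YoungDiagram.
Variables (n : nat) (lam : seq nat).
Hypothesis lam_young : is_young_diagram n lam.

Lemma young_sorted : sorted geq lam.
Proof. by case/and3P: lam_young. Qed.

Lemma young_sum : sumn lam = n.
Proof. by case/and3P: lam_young => _ _ /eqP. Qed.

Lemma young_nth_gt0 i : (i < size lam)%N -> (0 < nth 0 lam i)%N.
Proof.
move=> lt; case/and3P: lam_young => _ n0 _; rewrite lt0n.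
by apply: contraNneq n0 => <-; rewrite mem_nth.
Qed.

Lemma young_nth_succ i : (nth 0 lam i.+1 <= nth 0 lam i)%N.
Proof.
have [lt|le] := ltnP i.+1 (size lam); last by rewrite nth_default.
by have /(sortedP 0%N)/(_ i lt) := young_sorted.
Qed.

Lemma young_nth_mono i j : (i <= j)%N -> (nth 0 lam j <= nth 0 lam i)%N.
Proof.
elim: j => [|j IH]; first by rewrite leqn0 => /eqP ->.
rewrite leq_eqVlt => /orP[/eqP -> //|/IH]; apply: leq_trans.
exact: young_nth_succ.
Qed.

Lemma addable_row0 : addable_row lam 0.
Proof.
apply/(sortedP 0%N) => i _; rewrite /geq /= !nth_incr_nth.
by apply: leq_trans (young_nth_succ i) _; rewrite leq_addl.
Qed.

Lemma addable_rowS i : (i < size lam)%N ->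
  addable_row lam i.+1 = (nth 0 lam i.+1 < nth 0 lam i)%N.
Proof.
move=> lt; apply/(sortedP 0%N)/idP => [/(_ i)|h j _].
  rewrite size_incr_nth /geq /= !nth_incr_nth eqxx gtn_eqF // add0n add1n; apply.
  by case: ifP => // /negbT; rewrite -leqNgt.
rewrite /geq /= !nth_incr_nth eqSS; case: (eqVneq i j) => [<-|ne].
  by rewrite gtn_eqF // add0n add1n.
by apply: leq_trans (young_nth_succ j) _; rewrite leq_addl.
Qed.

(** The same condition as in [addable_rowS]: row [i] is removable exactly when row [i.+1] is
    addable. This pairing of corners drives [cauchyHE]. *)
Lemma removable_rowE i : (i < size lam)%N ->
  removable_row lam i = (nth 0 lam i.+1 < nth 0 lam i)%N.
Proof.
move=> lt; rewrite /removable_row young_nth_gt0 //=.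
have sz : size (set_nth 0%N lam i (nth 0 lam i).-1) = size lam.
  by rewrite size_set_nth; apply/maxn_idPr.
apply/(sortedP 0%N)/idP => [/(_ i)|h j _].
  rewrite sz /geq /= !nth_set_nth /= eqxx gtn_eqF // => h.
  have [lt'|le] := ltnP i.+1 (size lam); last by rewrite nth_default ?young_nth_gt0.
  by have := h lt'; have := young_nth_gt0 lt; case: (nth 0%N lam i).
rewrite /geq /= !nth_set_nth /=; case: (eqVneq j i) => [->|ne].
  by rewrite gtn_eqF // -ltnS prednK // young_nth_gt0.
have := young_nth_succ j; case: eqP => [->|//] le.
exact: leq_trans (leq_pred _) le.
Qed.

(** Rows that are not corners may be inserted freely: if row [i] is not removable, row [i.+1] has
    the same length, so its end content is one less and its numerator cancels the denominator of row
    [i]. *)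
Lemma cauchyHE (F : fieldType) (z : F) : (forall x : int, z - x%:~R != 0) ->
  cauchyH lam z = (z + (size lam)%:R) *
    \prod_(i < size lam) ((z - (content i (nth 0%N lam i))%:~R) /
                          (z - (content i (nth 0%N lam i))%:~R + 1)).
Proof.
move=> gz; rewrite /cauchyH /cauchyG invf_div.
pose a i := content i (nth 0%N lam i); pose A i : F := z - (a i)%:~R.
rewrite /addable_contents /removable_contents !big_map !big_filter.
have A1 i : A i + 1 = z - (a i - 1)%:~R.
  have -> : (a i - 1)%:~R = (a i)%:~R - 1 :> F by apply: intrB.
  by rewrite /A; ring.
have eR : \prod_(i <- iota 0 (size lam) | removable_row lam i)
    (z - (content i (nth 0%N lam i).-1)%:~R) =
  \prod_(0 <= i < size lam | removable_row lam i) (A i + 1).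
  rewrite /index_iota subn0 big_seq_cond [RHS]big_seq_cond; apply: eq_bigr => i.
  rewrite mem_iota add0n => /andP[/andP[_ lt] _]; rewrite A1; congr (z - _%:~R).
  by rewrite /a /content predn_int ?young_nth_gt0 // addrAC.
have eA : \prod_(i <- iota 0 (size lam).+1 | addable_row lam i) A i *
  \prod_(0 <= i < size lam | ~~ removable_row lam i) (A i + 1) =
  (z + (size lam)%:R) * \prod_(0 <= i < size lam) A i.
  (* The empty row just below the diagram supplies this factor. *)
  have -> : z + (size lam)%:R = A (size lam).
    by rewrite /A /a /content nth_default // sub0r intrN opprK.
  rewrite mulrC [RHS]mulrC -big_nat_recr //= [RHS](bigID (addable_row lam)) /=.
  rewrite /index_iota subn0 mulrC; congr (_ * _).
  have -> : iota 0 (size lam).+1 = index_iota 0 (size lam).+1 by rewrite /index_iota subn0.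
  rewrite [RHS]big_mkcond big_nat_recl //= addable_row0 mul1r -big_mkcond /=.
  rewrite -[X in iota _ X]subn0 -/(index_iota _ _) big_nat_cond [RHS]big_nat_cond.
  apply: eq_big => i.
    by case: ltnP => //= lt; rewrite addable_rowS // removable_rowE.
  move=> /andP[/andP[_ lt]]; rewrite removable_rowE // -leqNgt => le.
  have e : nth 0%N lam i.+1 = nth 0%N lam i.
    by apply/eqP; rewrite eqn_leq le young_nth_succ.
  by rewrite A1 /A /a /content e; congr (z - _%:~R); rewrite intS opprD addrA addrAC.
rewrite eR -(big_mkord predT (fun i => A i / (A i + 1))) prodf_div mulrA -eA.
rewrite [X in _ = _ / X](bigID (removable_row lam)) /= -mulrA; congr (_ * _).
set x := \prod_(_ <= _ < _ | _) _; set y := \prod_(_ <= _ < _ | _) _.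
have y0 : y != 0.
  by rewrite prodf_seq_neq0; apply/allP => i _; rewrite A1 gz implybT.
by rewrite invfM mulrA mulrAC divff // mul1r.
Qed.

Definition shifted_rows : 'I_(size lam) -> int :=
  fun i => (nth 0%N lam i + (size lam - i.+1))%N%:Z.

Lemma cauchyH_single (F : fieldType) (z : F) : (forall x : int, z - x%:~R != 0) ->
  cauchyH lam z = single_factor shifted_rows 1 (z + (size lam)%:R).
Proof.
move=> gz; rewrite cauchyHE // /single_factor big_ord1 subr0; congr (_ * _).
apply: eq_bigr => i _.
have e : (shifted_rows i)%:~R =
    (content i (nth 0%N lam i))%:~R + (size lam)%:R - 1 :> F.
  rewrite -[(size lam)%:R]/((size lam)%:~R) -[1]/(1%:~R) -intrD -intrB.
  by congr (_%:~R); rewrite /shifted_rows /content; have := ltn_ord i; lia.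
by congr (_ / _); rewrite e; ring.
Qed.

Lemma prod_cauchyH (F : fieldType) k (z : F) : (forall x : int, z - x%:~R != 0) ->
  \prod_(i < k) cauchyH lam (z - i%:R) = single_factor shifted_rows k (z + (size lam)%:R).
Proof.
move=> gz; elim: k => [|k IH].
  rewrite /single_factor !big_ord0 mul1r big1 // => i _.
  rewrite subr0 divff //; have := gz (shifted_rows i - (size lam)%:Z).
  by rewrite intrB opprB addrA addrAC.
have gz' (x : int) : z - k%:R - x%:~R != 0.
  by have := gz (k%:Z + x); rewrite intrD opprD addrA.
rewrite big_ord_recr /= IH cauchyH_single // -[k.+1]addn1 -(@single_factor_merge _ _ _ _ k 1).
  by congr (_ * single_factor _ _ _); ring.
by move=> x; have := gz (x - (size lam)%:Z); rewrite intrB opprB addrA addrAC.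
Qed.

Lemma shifted_rows_inj : injective shifted_rows.
Proof.
suff lt (i j : 'I_(size lam)) : (i < j)%N -> shifted_rows i != shifted_rows j.
  move=> i j /eqP; case: (ltngtP i j) => [/lt/negPf -> //|/lt|/val_inj //].
  by rewrite eq_sym => /negPf ->.
move=> ij; have := young_nth_mono (ltnW ij); rewrite /shifted_rows.
by have := ltn_ord i; have := ltn_ord j; lia.
Qed.

End YoungDiagram.

(** * The Young symmetrizer *)

Lemma leq_sum_inj (I : finType) (f g : I -> nat) :
  (forall x, (g x <= f x)%N) -> (\sum_x f x <= \sum_x g x)%N -> f =1 g.
Proof.
move=> le les x; apply/eqP; rewrite eqn_leq le andbT leqNgt; apply/negP => lt.
have : (\sum_x g x < \sum_x f x)%N; last by rewrite ltnNge les.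
by rewrite (bigD1 x) // [X in (_ < X)%N](bigD1 x) //= -addSn leq_add // leq_sum.
Qed.

Section Symmetrizer.
Variables (n : nat) (lam : seq nat).
Hypothesis lam_young : is_young_diagram n lam.

Definition box_row (x : 'I_n) : nat := reshape_index lam x.
Definition box_col (x : 'I_n) : nat := reshape_offset lam x.

Lemma box_lt (x : 'I_n) : (x < sumn lam)%N.
Proof. by rewrite (young_sum lam_young). Qed.

Lemma box_row_lt x : (box_row x < size lam)%N.
Proof. exact/reshape_indexP/box_lt. Qed.

Lemma box_col_lt x : (box_col x < nth 0 lam (box_row x))%N.
Proof. exact/reshape_offsetP/box_lt. Qed.

Lemma box_inj x y : box_row x = box_row y -> box_col x = box_col y -> x = y.
Proof.
move=> er ec; apply/val_inj; rewrite /= -(reshape_indexK lam x) -(reshape_indexK lam y).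
by rewrite -/(box_row x) -/(box_col x) er ec.
Qed.

Lemma box_exists r c : (c < nth 0 lam r)%N -> exists x, box_row x = r /\ box_col x = c.
Proof.
move=> lt; have ltn : (flatten_index lam r c < n)%N.
  by rewrite -(young_sum lam_young); apply: flatten_indexP.
by exists (Ordinal ltn); rewrite /box_row /box_col /= flatten_indexKl // flatten_indexKr.
Qed.

Lemma row_stabP (p : 'S_n) :
  reflect (forall x, box_row (p x) = box_row x) (p \in row_stab n lam).
Proof. by rewrite inE; apply: (iffP forallP) => h x; apply/eqP/h. Qed.

Lemma col_stabP (p : 'S_n) :
  reflect (forall x, box_col (p x) = box_col x) (p \in col_stab n lam).
Proof. by rewrite inE; apply: (iffP forallP) => h x; apply/eqP/h. Qed.

(* Moving each box up its column to the row given by the rank of its label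
   makes the row indices at most the labels. *)
Lemma column_sort (f : 'I_n -> nat) :
  (forall x y, box_col x = box_col y -> f x = f y -> x = y) ->
  exists2 q, q \in col_stab n lam & forall x, (box_row (q x) <= f x)%N.
Proof.
move=> f_inj; pose A x := [set y | (box_col y == box_col x) && (f y < f x)%N].
have A_le x : (#|A x| <= f x)%N.
  rewrite -(size_iota 0 (f x)) cardE -(size_map f); apply: uniq_leq_size.
    rewrite map_inj_in_uniq ?enum_uniq // => y z.
    rewrite !mem_enum !inE => /andP[/eqP ey _] /andP[/eqP ez _].
    by apply: f_inj; rewrite ey ez.
  by move=> _ /mapP[y + ->]; rewrite mem_enum inE mem_iota add0n => /andP[].
(* Otherwise every box of this column lies in one of the first [#|A x|] rows, while [x] and [A x]
   are [#|A x| + 1] boxes of the column. *)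
have A_col x : (box_col x < nth 0 lam #|A x|)%N.
  rewrite ltnNge; apply/negP => le.
  have le_row y : box_col y = box_col x -> (box_row y < #|A x|)%N.
    move=> e; rewrite ltnNge; apply/negP => /(young_nth_mono lam_young) le'.
    by have := box_col_lt y; rewrite e ltnNge (leq_trans le' le).
  have : (#|x |: A x| <= #|A x|)%N.
    rewrite -[X in (_ <= X)%N](size_iota 0) cardE -(size_map box_row); apply: uniq_leq_size.
      rewrite map_inj_in_uniq ?enum_uniq // => y z.
      have col_eq w : w \in x |: A x -> box_col w = box_col x.
        by rewrite !inE => /orP[/eqP -> //|/andP[/eqP]].
      by rewrite !mem_enum => /col_eq ey /col_eq ez er; apply: box_inj; rewrite // ey ez.
    move=> _ /mapP[y + ->]; rewrite mem_enum mem_iota add0n => hy; apply: le_row.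
    by move: hy; rewrite !inE => /orP[/eqP -> //|/andP[/eqP]].
  by rewrite cardsU1 inE ltnn andbF add1n ltnn.
have A_lt x y : box_col x = box_col y -> (f x < f y)%N -> (#|A x| < #|A y|)%N.
  move=> e lt; apply/proper_card/properP; split.
    by apply/subsetP => z; rewrite !inE e => /andP[-> /ltn_trans ->].
  by exists x; rewrite !inE ?e ?eqxx ?lt ?ltnn ?andbF.
have q_lt x : (flatten_index lam #|A x| (box_col x) < n)%N.
  by rewrite -[X in (_ < X)%N](young_sum lam_young); apply: flatten_indexP.
pose q x := Ordinal (q_lt x).
have q_row x : box_row (q x) = #|A x| by rewrite /box_row flatten_indexKl.
have q_col x : box_col (q x) = box_col x by rewrite /box_col flatten_indexKr.
have q_inj : injective q.
  move=> x y e; have ec : box_col x = box_col y by rewrite -q_col e q_col.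
  have er : #|A x| = #|A y| by rewrite -q_row e q_row.
  apply: f_inj => //; case: (ltngtP (f x) (f y)) => // lt.
    by have := A_lt _ _ ec lt; rewrite er ltnn.
  by have := A_lt _ _ (esym ec) lt; rewrite er ltnn.
exists (perm q_inj); first by apply/col_stabP => x; rewrite permE.
by move=> x; rewrite permE q_row.
Qed.

(** The rows of [q x] have the same total as the rows of [x], so the upper bound on the labels turns
    every inequality of [column_sort] into an equality. *)
Lemma column_sort_eq (f : 'I_n -> nat) :
  (forall x y, box_col x = box_col y -> f x = f y -> x = y) ->
  (\sum_x f x <= \sum_x box_row x)%N ->
  exists2 q, q \in col_stab n lam & forall x, f x = box_row (q x).
Proof.
move=> f_inj le; have [q qC leq] := column_sort f_inj; exists q => //.
apply: leq_sum_inj => //; apply: leq_trans le _.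
by rewrite [X in (X <= _)%N](reindex_inj (@perm_inj _ q)).
Qed.

Lemma row_stab1 : 1%g \in row_stab n lam.
Proof. by apply/row_stabP => x; rewrite perm1. Qed.

Lemma col_stab1 : 1%g \in col_stab n lam.
Proof. by apply/col_stabP => x; rewrite perm1. Qed.

Lemma row_stabM p q : p \in row_stab n lam -> q \in row_stab n lam ->
  (p * q)%g \in row_stab n lam.
Proof.
by move=> /row_stabP hp /row_stabP hq; apply/row_stabP => x; rewrite permM hq hp.
Qed.

Lemma col_stabM p q : p \in col_stab n lam -> q \in col_stab n lam ->
  (p * q)%g \in col_stab n lam.
Proof.
by move=> /col_stabP hp /col_stabP hq; apply/col_stabP => x; rewrite permM hq hp.
Qed.

Lemma row_stabV p : p \in row_stab n lam -> (p^-1)%g \in row_stab n lam.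
Proof. by move=> /row_stabP hp; apply/row_stabP => x; rewrite -{2}(permKV p x) hp. Qed.

Lemma col_stabV p : p \in col_stab n lam -> (p^-1)%g \in col_stab n lam.
Proof. by move=> /col_stabP hp; apply/col_stabP => x; rewrite -{2}(permKV p x) hp. Qed.

Lemma row_col_stab1 p : p \in row_stab n lam -> p \in col_stab n lam -> p = 1%g.
Proof.
move=> /row_stabP hr /col_stabP hc; apply/permP => x; rewrite perm1.
by apply: box_inj.
Qed.

(** Coefficients of the Young symmetrizer, kept in [int] so that positivity of sums of squares is
    available later. *)
Definition young_coef (x : 'S_n) : int :=
  \sum_(p in row_stab n lam) \sum_(q in col_stab n lam)
    (-1) ^+ q * (x == p * q)%g%:R.

Lemma young_coefMl p x : p \in row_stab n lam -> young_coef (p * x)%g = young_coef x.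
Proof.
move=> pR; rewrite /young_coef (reindex_inj (mulgI p)) /=.
apply: eq_big => p'; last first.
  by move=> _; apply: eq_bigr => q _; rewrite -mulgA (inj_eq (mulgI p)).
apply/idP/idP => [h|]; last exact: row_stabM.
by rewrite -(mulKg p p') row_stabM // row_stabV.
Qed.

Lemma young_coefMr q x : q \in col_stab n lam ->
  young_coef (x * q)%g = (-1) ^+ q * young_coef x.
Proof.
move=> qC; rewrite /young_coef mulr_sumr; apply: eq_bigr => p _.
rewrite (reindex_inj (mulIg q)) /= mulr_sumr; apply: eq_big => q'.
  apply/idP/idP => [h|h]; last exact: col_stabM.
  by rewrite -(mulgK q q') col_stabM // col_stabV.
by move=> _; rewrite mulgA (inj_eq (mulIg q)) odd_permM signr_addb mulrA [(-1) ^+ _ * _]mulrC.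
Qed.

Lemma young_coef1 : young_coef 1%g = 1.
Proof.
rewrite /young_coef (bigD1 1%g) ?row_stab1 //= (bigD1 1%g) ?col_stab1 //=.
rewrite mulg1 eqxx odd_perm1 mulr1 [X in _ + X + _]big1 => [|q /andP[_ ne]].
  rewrite addr0 big1 ?addr0 // => p /andP[pR ne]; rewrite big1 // => q qC.
  case: eqP => [e|]; rewrite ?mulr0 //; case/eqP: ne.
  apply: row_col_stab1 => //; have -> : p = (q^-1)%g by rewrite -[p](mulgK q) -e mul1g.
  exact: col_stabV.
by rewrite mul1g eq_sym (negPf ne) mulr0.
Qed.

(* von Neumann's lemma: a permutation outside row_stab * col_stab commutes a
   transposition of row_stab into one of col_stab. *)
Lemma young_coef_unique (F : 'S_n -> int) :
  (forall p x, p \in row_stab n lam -> F (p * x)%g = F x) ->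
  (forall q x, q \in col_stab n lam -> F (x * q)%g = (-1) ^+ q * F x) ->
  forall x, F x = F 1%g * young_coef x.
Proof.
move=> FR FC x; pose f y := box_row ((x^-1)%g y).
have [inj|] := boolP [forall y, forall z,
    (box_col y == box_col z) && (f y == f z) ==> (y == z)].
  (* No column contains a repeated label: sorting the columns exhibits [x] as an element of row_stab
     * col_stab. *)
  have [q qC eq] : exists2 q, q \in col_stab n lam & forall x, f x = box_row (q x).
    apply: column_sort_eq => [y z ey ez|].
      by apply/eqP; have /forallP/(_ y)/forallP/(_ z) := inj; rewrite ey ez !eqxx.
    by rewrite [X in (_ <= X)%N](reindex_inj (@perm_inj _ x^-1%g)).
  have pR : (x * q)%g \in row_stab n lam.
    by apply/row_stabP => y; rewrite permM -eq /f permK.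
  have -> : x = ((x * q) * 1 * q^-1)%g by rewrite mulg1 mulgK.
  rewrite FC ?col_stabV // young_coefMr ?col_stabV // FR // young_coefMl //.
  by rewrite young_coef1 mulr1 mulrC.
rewrite negb_forall => /existsP[y]; rewrite negb_forall => /existsP[z].
rewrite negb_imply => /andP[/andP[/eqP ec /eqP ef] ne].
(* A repeated label: [y] and [z] share a column and their preimages under [x] share a row, so
   [t * x = x * t'] forces the value at [x] to equal its opposite. *)
pose t' := tperm y z; pose t := tperm ((x^-1)%g y) ((x^-1)%g z).
have t'C : t' \in col_stab n lam.
  by apply/col_stabP => w; rewrite /t'; case: tpermP => // ->.
have tR : t \in row_stab n lam.
  by apply/row_stabP => w; rewrite /t; case: tpermP => // ->.
have tx : (t * x = x * t')%g.
  by rewrite /t -tpermJ conjgE invgK -!mulgA mulVg mulg1.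
have z0 (G : 'S_n -> int) : (forall p x, p \in row_stab n lam -> G (p * x)%g = G x) ->
  (forall q x, q \in col_stab n lam -> G (x * q)%g = (-1) ^+ q * G x) -> G x = 0.
  move=> GR GC; have := GR _ x tR; rewrite tx GC // /t' odd_tperm ne expr1 mulN1r => e.
  by move: e; lia.
rewrite z0 // [young_coef x]z0 ?mulr0 // => [p w|q w]; [exact: young_coefMl|exact: young_coefMr].
Qed.

End Symmetrizer.

(** * The character of the Specht module through the Young symmetrizer *)

Section YoungCharacter.
Variables (n : nat) (lam : seq nat).
Hypothesis lam_young : is_young_diagram n lam.

Local Notation E := (@young_coef n lam).

(** The coefficient of [y] in e x e. *)
Definition young_conv (x y : 'S_n) : int := \sum_u E u * E (x^-1 * u^-1 * y)%g.

Definition young_scalar : int := young_conv 1%g 1%g.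

Lemma young_scalarE : young_scalar = \sum_u E u * E u^-1%g.
Proof. by apply: eq_bigr => u _; rewrite invg1 mul1g mulg1. Qed.

Definition young_class_sum (g : 'S_n) : int := \sum_x E (x * g * x^-1)%g.

(** e x e transforms like e under row_stab on the left and col_stab on the right, so
    [young_coef_unique] makes it a multiple of e. *)
Lemma young_convE x y : young_conv x y = young_conv x 1%g * E y.
Proof.
apply: (young_coef_unique lam_young) => [p {}y pR|q {}y qC]; rewrite /young_conv.
  rewrite (reindex_inj (mulgI p)) /=; apply: eq_bigr => u _.
  by rewrite young_coefMl // invMg !mulgA mulgKV.
by rewrite mulr_sumr; apply: eq_bigr => u _; rewrite mulgA young_coefMr // mulrCA.
Qed.

Lemma young_class_sumJ y g : young_class_sum (y * g * y^-1)%g = young_class_sum g.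
Proof.
rewrite /young_class_sum (reindex_inj (mulIg y^-1%g)) /=; apply: eq_bigr => x _.
by rewrite !mulgA mulgKV invMg invgK mulgA mulgKV.
Qed.

(** The inverse of p q is conjugate, by q, to the product of the inverses of p and q, which occurs
    in e with the same sign. *)
Lemma young_class_sumV g : young_class_sum g^-1%g = young_class_sum g.
Proof.
rewrite /young_class_sum /young_coef exchange_big [RHS]exchange_big /=.
rewrite (reindex_inj invg_inj) /=; apply: eq_big => [p|p _].
  by apply/idP/idP => /row_stabV; rewrite ?invgK.
rewrite exchange_big [RHS]exchange_big /=.
rewrite (reindex_inj invg_inj) /=; apply: eq_big => [q|q _].
  by apply/idP/idP => /col_stabV; rewrite ?invgK.
rewrite (reindex_inj (mulgI q)) /=; apply: eq_bigr => x _.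
rewrite odd_permV; congr (_ * (nat_of_bool _)%:R).
rewrite -(inj_eq invg_inj) !invMg !invgK mulgA -!mulgA (inj_eq (mulgI q)) !mulgA.
by rewrite -(inj_eq (mulIg q)) mulgKV.
Qed.

Lemma sum_class_function (phi : 'S_n -> int) :
  (forall x g, phi (x * g * x^-1)%g = phi g) ->
  \sum_g young_class_sum g * phi g = (n`!)%:Z * \sum_g E g * phi g.
Proof.
move=> phiJ; rewrite /young_class_sum; under eq_bigr do rewrite mulr_suml.
rewrite exchange_big /= (eq_bigr (fun=> \sum_g E g * phi g)) => [|x _].
  by rewrite sumr_const card_Sn -mulr_natl natz.
rewrite (reindex_inj (conjg_inj x)) /=; apply: eq_bigr => g _.
rewrite conjgE -(phiJ x); congr (E _ * phi _); first by rewrite !mulgA mulgV mul1g mulgK.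
by rewrite !mulgA mulgV mul1g mulgK.
Qed.

(** For fixed [x] the inner sum is a coefficient of an element e x e, hence a product by
    [young_convE]. Summing over [x] gives the coefficient of the identity in e e e, which is c ^ 2
    because e e = c e and e has coefficient 1 at the identity. *)
Lemma sum_young_coef_class :
  \sum_g E g * young_class_sum g = young_scalar ^+ 2.
Proof.
under eq_bigr do rewrite -young_class_sumV /young_class_sum mulr_sumr.
rewrite exchange_big /= (eq_bigr (fun x => E x^-1%g * young_conv x^-1%g 1%g)) => [|x _].
  rewrite (reindex_inj invg_inj) /=.
  under eq_bigr do rewrite invgK /young_conv mulr_sumr.
  rewrite exchange_big /=.
  transitivity (\sum_u \sum_w E u * (E (w^-1)%g * E (u^-1 * w)%g)).
    apply: eq_bigr => u _; rewrite (reindex_inj (mulgI u^-1%g)) /=.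
    by apply: eq_bigr => w _; rewrite mulg1 invMg invgK mulgK mulrCA [E (_ * _)%g * _]mulrC.
  rewrite exchange_big /=.
  transitivity (\sum_w E w^-1%g * (young_scalar * E w)).
    apply: eq_bigr => w _; rewrite -young_convE /young_conv mulr_sumr.
    by apply: eq_bigr => u _; rewrite invg1 mul1g mulrCA.
  rewrite expr2 {3}young_scalarE mulr_sumr (reindex_inj invg_inj) /=.
  by apply: eq_bigr => w _; rewrite invgK mulrCA.
rewrite mulrC -young_convE /young_conv; apply: eq_bigr => u _.
by rewrite invgK.
Qed.

Lemma sum_young_class_sq :
  \sum_g young_class_sum g * young_class_sum g = (n`!)%:Z * young_scalar ^+ 2.
Proof.
rewrite sum_class_function ?sum_young_coef_class // => x g.
exact: young_class_sumJ.
Qed.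

Lemma young_class_sum1 : young_class_sum 1%g = (n`!)%:Z.
Proof.
rewrite /young_class_sum (eq_bigr (fun=> 1)) => [|x _].
  by rewrite sumr_const card_Sn -mulr_natl natz mulr1.
by rewrite mulg1 mulgV young_coef1.
Qed.

Local Notation G := [set: 'S_n]%G.
Local Notation rG := (regular_repr algC G).
Local Notation e := (young_symmetrizer n lam).
Local Notation U := (cyclic_mx rG e).
Local Notation dlt x := (delta_mx 0 (gring_index G x) : 'rV[algC]_#|G|).

Lemma young_symmetrizerE : e = \sum_x (E x)%:~R *: dlt x.
Proof.
rewrite /young_symmetrizer /young_coef.
under [RHS]eq_bigr do rewrite rmorph_sum scaler_suml.
rewrite [RHS]exchange_big /=; apply: eq_bigr => p _.
under [RHS]eq_bigr do rewrite rmorph_sum scaler_suml.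
rewrite [RHS]exchange_big /=; apply: eq_bigr => q _.
rewrite (bigD1 (p * q)%g) //= eqxx mulr1 rmorphXn /= rmorphN1 big1 ?addr0 // => x ne.
by rewrite (negPf ne) mulr0 scale0r.
Qed.

Lemma regular_delta x y : dlt x *m rG y = dlt (x * y)%g.
Proof. by rewrite -rowE rowK gring_indexK ?inE. Qed.

(** Left multiplication by e on the group algebra; it commutes with the right regular action. *)
Let L : 'M[algC]_#|G| := \matrix_i (e *m rG (enum_val i)).

Let delta_L x : dlt x *m L = e *m rG x.
Proof. by rewrite -rowE rowK gring_indexK ?inE. Qed.

Let L_comm g : L *m rG g = rG g *m L.
Proof.
apply/row_matrixP => i; rewrite !row_mul !rowK -rowE rowK gring_indexK ?inE //.
by rewrite -mulmxA -repr_mxM ?inE.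
Qed.

Let e_rG x : e *m rG x = \sum_y (E y)%:~R *: dlt (y * x)%g.
Proof.
rewrite young_symmetrizerE mulmx_suml; apply: eq_bigr => y _.
by rewrite -scalemxAl regular_delta.
Qed.

Let e_L : e *m L = young_scalar%:~R *: e.
Proof.
rewrite {1}young_symmetrizerE mulmx_suml.
transitivity (\sum_x \sum_w ((E x)%:~R * (E (w * x^-1)%g)%:~R) *: dlt w).
  apply: eq_bigr => x _; rewrite -scalemxAl delta_L e_rG scaler_sumr.
  rewrite (reindex_inj (mulIg x^-1%g)) /=; apply: eq_bigr => w _.
  by rewrite scalerA mulgKV.
rewrite exchange_big /= young_symmetrizerE scaler_sumr; apply: eq_bigr => w _.
rewrite -scaler_suml scalerA -intrM -young_convE; congr (_ *: _).
rewrite /young_conv rmorph_sum /=.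
rewrite (reindex_inj (mulIg w)) (reindex_inj invg_inj) /=; apply: eq_bigr => u _.
by rewrite intrM invMg invgK mulKVg invg1 mul1g mulrC.
Qed.

Let U_L m (W : 'M[algC]_(m, #|G|)) : (W <= U)%MS -> W *m L = young_scalar%:~R *: W.
Proof.
move=> sWU; apply/row_matrixP => i; rewrite row_mul linearZ /=.
have /cyclic_mxP[A /envelop_mxP[a ->] ->] : (row i W <= U)%MS.
  exact: submx_trans (row_sub _ _) sWU.
rewrite !mulmx_sumr mulmx_suml scaler_sumr; apply: eq_bigr => g _.
rewrite -mulmxA -scalemxAl -L_comm -!scalemxAr mulmxA e_L.
by rewrite scalemxAl scalerA mulrC -scalerA -!scalemxAl.
Qed.

Let L_sub : (L <= U)%MS.
Proof.
apply/row_subP => i; rewrite rowK; apply/cyclic_mxP.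
by exists (rG (enum_val i)); rewrite ?envelop_mx_id ?inE.
Qed.

(** [L] maps the whole algebra into the right ideal [U] and acts on [U] as the scalar c, so c times
    the trace of [g] on [U] is the trace of [L *m rG g] on the algebra, computed on the basis of
    group elements. *)
Lemma specht_trace g :
  young_scalar%:~R * \tr (specht_repr n lam g) = (young_class_sum g)%:~R.
Proof.
pose B : 'M_(\rank U, #|G|) := val_submod 1%:M.
have BU : (B *m rG g <= U)%MS.
  by rewrite mxmodule_trans ?cyclic_mx_module ?inE // /B val_submod1.
have -> : young_scalar%:~R * \tr (specht_repr n lam g) = \tr (L *m rG g).
  rewrite -[X in _ = \tr (X *m _)](in_submodK L_sub) val_submodE -/B -mulmxA.
  rewrite [in RHS]in_submodE -mulmxA [in RHS]mulmxA [RHS]mxtrace_mulC mulmxA (U_L BU). 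
  by rewrite -scalemxAl mxtraceZ -in_submodE.
rewrite /mxtrace -young_class_sumV /young_class_sum rmorph_sum /=.
rewrite (reindex_onto (gring_index G) enum_val) /=; last by move=> i _; apply: gring_valK.
apply: eq_big => [x|x _].
  by rewrite gring_indexK ?inE ?eqxx.
transitivity ((dlt x *m (L *m rG g)) 0 (gring_index G x)); first by rewrite -rowE [RHS]mxE.
rewrite mulmxA delta_L -mulmxA -repr_mxM ?inE // e_rG summxE.
have gi_inj : injective (gring_index G).
  by move=> y z e'; rewrite -[y](@gring_indexK _ G) ?inE // e' gring_indexK ?inE.
rewrite (bigD1 (x * g^-1 * x^-1)%g) //= !mxE mulgA mulgKV mulgKV !eqxx mulr1 big1 ?addr0 //.
move=> y ne; rewrite !mxE (inj_eq gi_inj) eqxx /=.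
case: eqP => [e'|]; rewrite ?mulr0 //; case/eqP: ne.
by rewrite {1}e' !mulgA !mulgK.
Qed.

End YoungCharacter.

(** * The Frobenius class function *)

(* The coefficient of x^mu in the alternant det (x_i ^ nu_j). *)
Definition alt_delta m (mu nu : 'I_m -> int) : int :=
  \sum_(w : 'S_m) (-1) ^+ w * [forall i, mu i == nu (w i)]%:R.

Definition staircase m (j : 'I_m) : int := (m - j.+1)%N%:Z.

Definition content_of (T : finType) n (f : {ffun 'I_n -> T}) (t : T) : nat :=
  #|[set x | f x == t]|.

(* The coefficient of x^mu in det (x_i ^ (m-1-j)) times the power sum p_(type g),
   expanded over the g-invariant colourings f of the points. *)
Definition alt_char n m (mu : 'I_m -> int) (g : 'S_n) : int :=
  \sum_(f : {ffun 'I_n -> 'I_m} | [forall x, f (g x) == f x])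
    alt_delta (fun i => mu i - (content_of f i)%:Z) (@staircase m).

Lemma eq_alt_delta m (mu mu' nu nu' : 'I_m -> int) :
  mu =1 mu' -> nu =1 nu' -> alt_delta mu nu = alt_delta mu' nu'.
Proof.
move=> e e'; apply: eq_bigr => w _; congr (_ * (nat_of_bool _)%:R).
by apply: eq_forallb => i; rewrite e e'.
Qed.

Lemma staircase_inj m : injective (@staircase m).
Proof.
move=> i j; rewrite /staircase => -[e]; apply/val_inj => /=.
by have := ltn_ord i; have := ltn_ord j; lia.
Qed.

Lemma alt_delta_perm m (nu : 'I_m -> int) (u : 'S_m) : injective nu ->
  alt_delta (nu \o u) nu = (-1) ^+ u.
Proof.
move=> nu_inj; rewrite /alt_delta (bigD1 u) //= big1 => [|w ne].
  by rewrite addr0 (_ : [forall i, _]) ?mulr1 //; apply/forallP => i; exact/eqP.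
case: forallP => [h|]; rewrite ?mulr0 //; case/eqP: ne.
by apply/permP => i; apply/esym/nu_inj/eqP/h.
Qed.

Lemma alt_delta_refl m (mu : 'I_m -> int) : injective mu -> alt_delta mu mu = 1.
Proof.
move=> mu_inj; transitivity (alt_delta (mu \o (1%g : 'S_m)) mu).
  by apply: eq_alt_delta => // i /=; rewrite perm1.
by rewrite alt_delta_perm ?odd_perm1.
Qed.

Lemma alt_char_class n m (mu : 'I_m -> int) (x g : 'S_n) :
  alt_char mu (x * g * x^-1)%g = alt_char mu g.
Proof.
pose h (f : {ffun 'I_n -> 'I_m}) := [ffun y => f (x y)].
pose h' (f : {ffun 'I_n -> 'I_m}) := [ffun y => f ((x^-1)%g y)].
have hK : cancel h h' by move=> f; apply/ffunP => y; rewrite !ffunE permKV.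
have h'K : cancel h' h by move=> f; apply/ffunP => y; rewrite !ffunE permK.
rewrite /alt_char (reindex_inj (can_inj hK)) /=; apply: eq_big => [f|f _].
  apply/forallP/forallP => [H y|H y].
    by have := H ((x^-1)%g y); rewrite !ffunE !permM !permKV.
  by rewrite !ffunE !permM permKV.
apply: eq_alt_delta => // i; congr (_ - _%:Z); rewrite /content_of.
rewrite -(card_imset _ (@perm_inj _ x)); apply: eq_card => y.
apply/imsetP/idP => [[z + ->]|]; rewrite !inE ?ffunE // => hy.
by exists ((x^-1)%g y); rewrite ?inE ?ffunE permKV.
Qed.

Lemma sum_content n m (f : {ffun 'I_n -> 'I_m}) (c : 'I_m -> nat) :
  (\sum_x c (f x) = \sum_i c i * content_of f i)%N.
Proof.
rewrite (partition_big f predT) //=; apply: eq_bigr => i _.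
rewrite (eq_bigr (fun=> c i)) => [|x /eqP -> //].
by rewrite sum_nat_const mulnC; congr (_ * _)%N; apply: eq_card => x; rewrite inE.
Qed.

(** The rearrangement inequality, by summing 2 i w(i) <= i ^ 2 + w(i) ^ 2. *)
Lemma sum_perm_sq m (w : 'S_m) :
  (\sum_(i < m) i * w i <= \sum_(i < m) i * i)%N.
Proof.
have e : (\sum_(i < m) w i * w i = \sum_(i < m) i * i)%N.
  by rewrite [RHS](reindex_inj (@perm_inj _ w)).
rewrite -(leq_pmul2l (isT : (0 < 2)%N)) [X in (_ <= X)%N]mul2n -addnn -{2}e -big_split /=.
rewrite big_distrr /=; apply: leq_sum => i _; exact: (nat_Cauchy i (w i)).1.
Qed.

(** * Pairing the Young symmetrizer with the Frobenius class function *)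

Section Pairing.
Variables (n : nat) (lam : seq nat).
Hypothesis lam_young : is_young_diagram n lam.

Local Notation m := (size lam).
Local Notation E := (@young_coef n lam).
Local Notation mu := (@shifted_rows lam).

Let f0 (q : 'S_n) : {ffun 'I_n -> 'I_m} :=
  [ffun x => Ordinal (box_row_lt lam_young (q x))].

Lemma content_rows (q : 'S_n) i : content_of (f0 q) i = nth 0%N lam i.
Proof.
have -> : content_of (f0 q) i = #|[set x : 'I_n | box_row lam x == i]|.
  rewrite /content_of -(card_imset _ (@perm_inj _ q)); apply: eq_card => y.
  apply/imsetP/idP => [[x + ->]|]; rewrite !inE ?ffunE -?val_eqE // => hy.
  by exists ((q^-1)%g y); rewrite ?inE ?ffunE -?val_eqE /= permKV.
rewrite cardE -(size_map (box_col lam)) -[RHS](size_iota 0); apply/perm_size/uniq_perm.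
- rewrite map_inj_in_uniq ?enum_uniq // => x y.
  by rewrite !mem_enum !inE => /eqP ex /eqP ey; apply: box_inj; rewrite ex ey.
- exact: iota_uniq.
move=> c; rewrite mem_iota add0n; apply/mapP/idP => [[x + ->]|lt].
  by rewrite mem_enum inE => /eqP <-; apply: box_col_lt.
have [x [ex ec]] := box_exists lam_young lt.
by exists x; rewrite // mem_enum inE ex.
Qed.

(** The transposition of [y] and [z] preserves [f] and lies in col_stab, so right translation by it
    reverses the sign of the sum. *)
Lemma sum_fix_eq0 (f : {ffun 'I_n -> 'I_m}) y z :
  y != z -> box_col lam y = box_col lam z -> f y = f z ->
  \sum_(g : 'S_n | [forall x, f (g x) == f x]) E g = 0.
Proof.
move=> ne ec ef; pose t := tperm y z.
have tC : t \in col_stab n lam.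
  by apply/col_stabP => w; rewrite /t; case: tpermP => // ->.
have ft w : f (t w) = f w by rewrite /t; case: tpermP => // ->.
set s := \sum_(_ | _) _; suff : s = - s by lia.
rewrite {1}/s (reindex_inj (mulIg t)) -sumrN; apply: eq_big => [g|g _].
  by apply: eq_forallb => x; rewrite permM ft.
by rewrite young_coefMr // /t odd_tperm ne expr1 mulN1r.
Qed.

(** A nonzero [alt_delta] gives a permutation w such that colour i is used lam_i - i + w(i) times.
    By [sum_perm_sq] the sum of all colours is then at most that of the row filling, and
    [column_sort_eq] applies. *)
Lemma column_filling (f : {ffun 'I_n -> 'I_m}) :
  (forall y z, box_col lam y = box_col lam z -> f y = f z -> y = z) ->
  alt_delta (fun i => mu i - (content_of f i)%:Z) (@staircase m) != 0 ->
  exists2 q, q \in col_stab n lam & f = f0 q.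
Proof.
move=> f_inj nz.
have [w hw] : exists w : 'S_m, forall i, mu i - (content_of f i)%:Z = staircase (w i).
  case: (pickP (fun w : 'S_m => [forall i, mu i - (content_of f i)%:Z == staircase (w i)])).
    by move=> w /forallP h; exists w => i; apply/eqP.
  by move=> h; move: nz; rewrite /alt_delta big1 ?eqxx // => w _; rewrite h mulr0.
have [|| q qC eq] := @column_sort_eq _ _ lam_young (fun x => f x : nat).
- by move=> y z ec /val_inj; apply: f_inj.
- rewrite (sum_content f (fun i => i)).
  have -> : (\sum_(x : 'I_n) box_row lam x = \sum_(i < m) i * nth 0 lam i)%N.
    rewrite (eq_bigr (fun x => f0 1%g x : nat)) => [|x _]; last by rewrite ffunE /= perm1.
    by rewrite (sum_content (f0 1%g) (fun i => i)); apply: eq_bigr => i _; rewrite content_rows.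
  have le := sum_perm_sq w.
  have e : forall i : 'I_m, (content_of f i + i = nth 0 lam i + w i)%N.
    move=> i; have := hw i; rewrite /shifted_rows /staircase.
    by have := ltn_ord i; have := ltn_ord (w i); lia.
  rewrite -(leq_add2r (\sum_(i < m) i * i)) -big_split /=.
  rewrite (eq_bigr (fun i : 'I_m => i * nth 0 lam i + i * w i)%N) => [|i _].
    by rewrite big_split leq_add2l.
  by rewrite -!mulnDr e.
exists q => //; apply/ffunP => x; apply/val_inj; rewrite ffunE /=; exact: eq.
Qed.

Lemma alt_delta_rows q :
  alt_delta (fun i => mu i - (content_of (f0 q) i)%:Z) (@staircase m) = 1.
Proof.
transitivity (alt_delta (@staircase m \o (1%g : 'S_m)) (@staircase m)); last first.
  by rewrite alt_delta_perm ?odd_perm1 //; apply: staircase_inj.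
apply: eq_alt_delta => // i; rewrite /= perm1 content_rows /shifted_rows /staircase.
by lia.
Qed.

(** Only the colourings [f0 q] with [q] in col_stab survive, each with coefficient 1. The stabilizer
    of [f0 q] is a conjugate of row_stab by [q], and the remaining signed double sum is the pairing
    of e with its own inverse, namely c. *)
Lemma sum_young_alt_char : \sum_g E g * alt_char mu g = young_scalar n lam.
Proof.
pose S (f : {ffun 'I_n -> 'I_m}) := \sum_(g : 'S_n | [forall x, f (g x) == f x]) E g.
pose X (f : {ffun 'I_n -> 'I_m}) :=
  alt_delta (fun i => mu i - (content_of f i)%:Z) (@staircase m).
have -> : \sum_g E g * alt_char mu g = \sum_f X f * S f.
  rewrite /alt_char; under eq_bigr do rewrite mulr_sumr big_mkcond.
  rewrite exchange_big /=; apply: eq_bigr => f _.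
  rewrite /S mulr_sumr [RHS]big_mkcond; apply: eq_bigr => g _.
  by case: ifP; rewrite // mulrC.
have f0_inj : {in col_stab n lam &, injective f0}.
  move=> q q' /col_stabP qC /col_stabP qC' /ffunP e; apply/permP => x.
  apply: (box_inj (lam := lam)); last by rewrite qC qC'.
  by have /(congr1 val) := e x; rewrite !ffunE.
rewrite (bigID (mem (f0 @: col_stab n lam))) /= [X in _ + X]big1 ?addr0; last first.
  move=> f /imsetP nf.
  have [inj|] := boolP [forall y, forall z,
      (box_col lam y == box_col lam z) && (f y == f z) ==> (y == z)].
    have [->|nz] := eqVneq (X f) 0; first by rewrite mul0r.
    case: nf; have [|q qC ->] := column_filling _ nz; last by exists q.
    move=> y z ey ez; apply/eqP.
    by have /forallP/(_ y)/forallP/(_ z) := inj; rewrite ey ez !eqxx.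
  rewrite negb_forall => /existsP[y]; rewrite negb_forall => /existsP[z].
  rewrite negb_imply => /andP[/andP[/eqP ec /eqP ef] ne].
  by rewrite /S (sum_fix_eq0 ne) // mulr0.
rewrite big_imset //= young_scalarE.
have eS q : q \in col_stab n lam ->
    X (f0 q) * S (f0 q) = \sum_(p in row_stab n lam) (-1) ^+ q * E (q * p)%g.
  move=> qC; rewrite /X alt_delta_rows mul1r /S.
  rewrite (reindex_inj (mulgI q)) (reindex_inj (mulIg q^-1%g)) /=.
  apply: eq_big => [p|p _]; last first.
    by rewrite mulgA [LHS]young_coefMr ?col_stabV // odd_permV.
  apply/forallP/row_stabP => [h x|h x].
    have := h ((q^-1)%g x); rewrite !ffunE !permM !permKV => /eqP/(congr1 val) /=.
    done.
  by rewrite !ffunE; apply/eqP/val_inj; rewrite /= !permM permKV h.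
rewrite (eq_bigr _ eS) exchange_big /=.
transitivity (\sum_(p in row_stab n lam) \sum_(q in col_stab n lam)
   (-1) ^+ q * E ((p * q)^-1)%g).
  rewrite (reindex_inj invg_inj) /=; apply: eq_big => [p|p _].
    by apply/idP/idP => /row_stabV; rewrite ?invgK.
  rewrite (reindex_inj invg_inj) /=; apply: eq_big => [q|q _].
    by apply/idP/idP => /col_stabV; rewrite ?invgK.
  by rewrite odd_permV invMg.
under [RHS]eq_bigr do rewrite {1}/young_coef mulr_suml.
rewrite [RHS]exchange_big /=; apply: eq_bigr => p _.
under [RHS]eq_bigr do rewrite mulr_suml.
rewrite [RHS]exchange_big /=; apply: eq_bigr => q _.
rewrite (bigD1 (p * q)%g) //= eqxx mulr1 big1 ?addr0 // => x ne.
by rewrite (negPf ne) mulr0 mul0r.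
Qed.

End Pairing.

(** * Colourings with a given content *)

Section Colorings.
Variables (n : nat) (T : finType).
Implicit Types (f h : {ffun 'I_n -> T}).

Lemma content_of_count f t : content_of f t = count_mem t [seq f i | i <- enum 'I_n].
Proof.
rewrite /content_of count_map -sum1_card -sum1_count big_enum_cond.
by apply: eq_bigl => x; rewrite inE.
Qed.

Lemma content_of_transitive f h : content_of f =1 content_of h ->
  exists s : 'S_n, forall x, f x = h (s x).
Proof.
move=> e; pose th := [tuple h i | i < n].
have : perm_eq [tuple f i | i < n] th.
  by apply/allP => t _; rewrite /= -!content_of_count e.
case/tuple_permP => s /(congr1 (fun s => nth (f _) s _)) e'; exists s => x.
have := e' x x; rewrite -!tnth_nth !tnth_mktuple; apply.
Qed.

Lemma content_of_sum f : (\sum_t content_of f t = n)%N.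
Proof.
rewrite /content_of (eq_bigr (fun t => \sum_(x | f x == t) 1)%N) => [|t _].
  transitivity (\sum_(x < n) 1)%N; first by rewrite [RHS](partition_big f predT).
  by rewrite sum1_card card_ord.
by rewrite -sum1_card; apply: eq_bigl => x; rewrite inE.
Qed.

Lemma content_of_surj (a : T -> nat) : (\sum_t a t = n)%N ->
  exists f, content_of f =1 a.
Proof.
move=> sa; pose s := flatten [seq nseq (a t) t | t <- enum T].
have sz : size s == n.
  rewrite size_flatten /shape -map_comp sumnE big_map big_enum -[X in _ == X]sa.
  by apply/eqP/eq_bigr => t _ /=; rewrite size_nseq.
exists [ffun x => tnth (Tuple sz) x] => t; rewrite content_of_count.
rewrite (eq_map (ffunE _)) map_tnth_enum /= count_flatten -map_comp sumnE big_map big_enum.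
rewrite (bigD1 t) //= count_nseq /= eqxx mul1n big1 ?addn0 // => u ne.
by rewrite count_nseq /= (negPf ne).
Qed.

(* Burnside: the colourings with a given content form one orbit of 'S_n. *)
Lemma sum_fixed_colorings (X : {ffun T -> 'I_n.+1} -> int) :
  \sum_(g : 'S_n) \sum_(f : {ffun 'I_n -> T} | [forall x, f (g x) == f x])
     X [ffun t => inord (content_of f t)] =
  (n`!)%:Z * \sum_(a : {ffun T -> 'I_n.+1} | (\sum_t a t == n)%N) X a.
Proof.
pose cont f : {ffun T -> 'I_n.+1} := [ffun t => inord (content_of f t)].
have contE f t : cont f t = content_of f t :> nat.
  rewrite ffunE inordK // ltnS -[X in (_ <= X)%N](content_of_sum f).
  by rewrite (bigD1 t) //= leq_addr.
have sum_cont f : (\sum_t cont f t == n)%N.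
  by apply/eqP; rewrite -[RHS](content_of_sum f); apply: eq_bigr => t _; rewrite contE.
rewrite (exchange_big_dep predT) //= mulr_sumr.
rewrite (partition_big cont (fun a => \sum_t a t == n)%N) //=.
apply: eq_bigr => a /eqP sa.
have [h0 h0a] := content_of_surj sa.
have ca f : cont f == a -> forall t, content_of f t = a t.
  by move=> /eqP <- t; rewrite contE.
(* The stabilizer of [f] is translated to the coset of those [s] that carry [h0] to [f]; over all
   [f] these cosets partition the group. *)
transitivity (\sum_(f | cont f == a) \sum_(s : 'S_n | [forall x, f x == h0 (s x)]) X a).
  apply: eq_bigr => f fa.
  have [s0 hs0] : exists s : 'S_n, forall x, f x = h0 (s x).
    by apply: content_of_transitive => t; rewrite h0a ca.
  rewrite [RHS](reindex_inj (mulIg s0)) /=; apply: eq_big => [g|g _].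
    by apply: eq_forallb => x; rewrite permM -hs0 eq_sym.
  by rewrite -/(cont f) (eqP fa).
rewrite (exchange_big_dep predT) //= (eq_bigr (fun=> X a)) => [|s _].
  by rewrite sumr_const card_Sn -mulr_natl natz.
rewrite (big_pred1 [ffun x => h0 (s x)]) // => f /=.
apply/andP/eqP => [[_ /forallP h]|->].
  by apply/ffunP => x; rewrite ffunE; apply/eqP.
split; last by apply/forallP => x; rewrite ffunE.
apply/eqP/ffunP => t; apply/val_inj.
apply: etrans (contE _ _) (etrans _ (h0a t)); rewrite /content_of.
rewrite -(card_imset _ (@perm_inj _ s)); apply: eq_card => y.
apply/imsetP/idP => [[x + ->]|]; rewrite !inE ?ffunE // => hy.
by exists ((s^-1)%g y); rewrite ?inE ?ffunE permKV.
Qed.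

End Colorings.

Lemma sum_nat_cond_swap (F : nat -> int) a b :
  \sum_(0 <= k < a | (k < b)%N) F k = \sum_(0 <= k < b | (k < a)%N) F k.
Proof.
rewrite (big_nat_widen _ _ (a + b)%N) ?leq_addr //.
rewrite [RHS](big_nat_widen _ _ (a + b)%N) ?leq_addl //.
by apply: eq_bigl => k; rewrite andbC.
Qed.

(** * Coefficients of alternants *)

Section AltDelta.
Variables (m : nat).
Implicit Types (mu nu : 'I_m -> int).

Lemma alt_delta_tperm mu nu i j : i != j ->
  alt_delta (mu \o tperm i j) nu = - alt_delta mu nu.
Proof.
move=> ne; rewrite /alt_delta (reindex_inj (mulgI (tperm i j))) -sumrN /=.
apply: eq_bigr => w _; rewrite odd_permM odd_tperm ne addTb.
rewrite signrN mulNr; congr (- (_ * (nat_of_bool _)%:R)).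
apply/forallP/forallP => h x; have := h (tperm i j x); rewrite /= permM ?tpermK //.
Qed.

Lemma alt_delta_eq0 mu nu i j : i != j -> mu i = mu j -> alt_delta mu nu = 0.
Proof.
move=> ne e; have := alt_delta_tperm mu nu ne.
rewrite (@eq_alt_delta _ _ mu _ nu) // => [|x /=]; first by lia.
by case: tpermP => [->|->|].
Qed.

Lemma alt_delta_ninj mu nu : ~ injective mu -> alt_delta mu nu = 0.
Proof.
move=> ninj; case: (pickP (fun ij => (ij.1 != ij.2) && (mu ij.1 == mu ij.2))) => [[i j]|h].
  by move=> /andP[/= ne /eqP e]; apply: (alt_delta_eq0 _ ne e).
case: ninj => i j e; apply/eqP/negPn/negP => ne.
by have := h (i, j); rewrite /= ne e eqxx.
Qed.

Definition shift_boxes mu (k : nat) (i j : 'I_m) : 'I_m -> int :=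
  fun x => mu x - (if x == i then k%:Z else 0) + (if x == j then k%:Z else 0).

(* Along the line mu_i + mu_j = const the alternating function alt_delta sums
   to 0; the two sums below are this line without its point mu. *)
Lemma alt_delta_pair mu nu i j (p q : nat) : i != j -> mu i = p -> mu j = q ->
  \sum_(k < p) alt_delta (shift_boxes mu k.+1 i j) nu +
  \sum_(k < q) alt_delta (shift_boxes mu k.+1 j i) nu = - alt_delta mu nu.
Proof.
move=> ne ep eq; have nji : (j == i) = false by rewrite eq_sym; apply: negPf.
(* The point with value [t] at [i] and [p + q - t] at [j]; [t = p] is [mu], and swapping [i] and [j]
   reverses the line. *)
pose line (t : nat) x : int :=
  if x == i then t%:Z else if x == j then (p + q)%:Z - t%:Z else mu x.
pose g t := alt_delta (line t) nu.
have gE x t : (forall y, x y = line t y) -> alt_delta x nu = g t.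
  by move=> e; apply: eq_alt_delta.
have gN (t : nat) : (t <= p + q)%N -> g (p + q - t)%N = - g t.
  move=> le; rewrite /g -(alt_delta_tperm _ _ ne); apply: eq_alt_delta => // x.
  rewrite /line /=; case: tpermP => [->|->|/eqP/negPf -> /eqP/negPf -> //].
    by rewrite !eqxx nji; lia.
  by rewrite !eqxx nji; lia.
have g0 : \sum_(t < p + q.+1) g t = 0.
  set s := \sum_(_ < _) _; suff : s = - s by lia.
  rewrite {1}/s (reindex_inj rev_ord_inj) -sumrN; apply: eq_bigr => t _ /=.
  by rewrite -gN; [congr g; have := ltn_ord t; lia | have := ltn_ord t; lia].
have {g0} : \sum_(k < p) g (p - k.+1)%N + (g p + \sum_(k < q) g (p + k.+1)%N) = 0.
  rewrite -[RHS]g0 big_split_ord big_ord_recl /= addn0; congr (_ + _).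
  by rewrite [RHS](reindex_inj rev_ord_inj).
have -> : alt_delta mu nu = g p.
  apply: gE => y; rewrite /line; case: eqP => [->//|_]; case: eqP => [->|//].
  by rewrite eq; lia.
have -> : \sum_(k < p) alt_delta (shift_boxes mu k.+1 i j) nu = \sum_(k < p) g (p - k.+1)%N.
  apply: eq_bigr => k _; apply: gE => y; rewrite /line /shift_boxes.
  have := ltn_ord k; case: (eqVneq y i) => [->|_]; first by rewrite (negPf ne) ep; lia.
  by case: eqP => [->|_]; rewrite ?eq; lia.
have -> : \sum_(k < q) alt_delta (shift_boxes mu k.+1 j i) nu = \sum_(k < q) g (p + k.+1)%N.
  apply: eq_bigr => k _; apply: gE => y; rewrite /line /shift_boxes.
  have := ltn_ord k; case: (eqVneq y i) => [->|_]; first by rewrite (negPf ne) ep; lia.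
  by case: eqP => [->|_]; rewrite ?eq; lia.
lia.
Qed.

Lemma sum_staircase2 : (\sum_(i < m) @staircase m i) *+ 2 = (m * m.-1)%N%:Z.
Proof.
rewrite mulr2n {1}(reindex_inj rev_ord_inj) -big_split /=.
rewrite (eq_bigr (fun=> m.-1%:Z)) => [|i _].
  by rewrite sumr_const card_ord -mulr_natl natz PoszM.
by rewrite /staircase /=; have := ltn_ord i; lia.
Qed.

(** The sum is doubled so that the pairs (i, j) and (j, i) combine through [alt_delta_pair]: each of
    the m (m - 1) ordered pairs contributes minus [alt_delta mu nu], and m (m - 1) is twice the
    staircase sum. *)
Lemma alt_delta_offdiag mu nu : (forall i, 0 <= mu i) ->
  \sum_i \sum_(j | j != i) \sum_(k < `|mu i|) alt_delta (shift_boxes mu k.+1 i j) nu =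
  - (\sum_i @staircase m i) * alt_delta mu nu.
Proof.
move=> mu0; set s := LHS; suff : s *+ 2 = - ((\sum_i @staircase m i) *+ 2 * alt_delta mu nu).
  by rewrite mulrnAl mulNr; lia.
rewrite sum_staircase2 mulr2n {2}/s (exchange_big_dep predT) //= -big_split /=.
rewrite (eq_bigr (fun=> - (alt_delta mu nu *+ m.-1))) => [|i _].
  by rewrite sumr_const card_ord mulNrn -mulrnA mulnC -mulr_natl natz.
rewrite [X in _ + X](eq_bigl (fun j => j != i)) => [|j]; last by rewrite eq_sym.
rewrite -big_split /= (eq_bigr (fun=> - alt_delta mu nu)) => [|j ne].
  rewrite sumr_const mulNrn; congr (- (_ *+ _)).
  by rewrite cardC1 card_ord.
by rewrite eq_sym in ne; apply: alt_delta_pair; rewrite // gez0_abs.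
Qed.

(** In the term of the permutation w, lowering [nu] at [w j] imposes the same condition as raising
    [mu] at [j]. *)
Lemma sum_lower_swap mu nu k i :
  \sum_j alt_delta (lower mu k i) (lower nu k j) =
  \sum_j alt_delta (shift_boxes mu k i j) nu.
Proof.
rewrite /alt_delta exchange_big [RHS]exchange_big /=; apply: eq_bigr => w _.
rewrite (reindex_inj (@perm_inj _ w)) /=; apply: eq_bigr => j _.
congr (_ * (nat_of_bool _)%:R); apply: eq_forallb => x.
rewrite /lower /shift_boxes (inj_eq perm_inj).
by case: (x == i); case: (x == j); apply/eqP/eqP; lia.
Qed.

(** [column_sort] for the diagram that consists of a single column of [m] boxes. *)
Lemma injective_sort (f : 'I_m -> nat) : injective f ->
  exists q : 'S_m, (forall x, (q x <= f x)%N) /\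
    ((\sum_x f x <= \sum_(x < m) x)%N -> forall x, f x = q x).
Proof.
move=> f_inj.
have yd : is_young_diagram m (nseq m 1%N).
  apply/and3P; split.
  - by apply/(sortedP 0%N) => i; rewrite size_nseq => lt; rewrite !nth_nseq lt ltnW.
  - by rewrite mem_nseq andbF.
  - by rewrite sumn_nseq mul1n.
have col0 x : box_col (n := m) (nseq m 1%N) x = 0%N.
  have := box_col_lt yd x; rewrite nth_nseq; case: ifP => _; last by rewrite ltn0.
  by case: (box_col _ _).
have rowE x : box_row (n := m) (nseq m 1%N) x = x.
  rewrite -[RHS](reshape_indexK (nseq m 1%N)) -/(box_row _ x) -/(box_col _ x) col0.
  rewrite /flatten_index addn0 take_nseq ?sumn_nseq ?mul1n //.
  by have := box_row_lt yd x; rewrite size_nseq => /ltnW.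
have h x y : box_col (nseq m 1%N) x = box_col (nseq m 1%N) y -> f x = f y -> x = y.
  by move=> _; apply: f_inj.
have [q _ le] := column_sort yd h; exists q; split=> [x|les]; first by rewrite -rowE.
apply: leq_sum_inj => [x|]; first by rewrite -rowE.
by apply: leq_trans les _; rewrite [X in (X <= _)%N](reindex_inj (@perm_inj _ q)).
Qed.

Lemma sum_staircase : \sum_i @staircase m i = (\sum_(i < m) i)%N%:Z.
Proof.
rewrite [in RHS](reindex_inj rev_ord_inj) /= -natz natr_sum.
by apply: eq_bigr => i _; rewrite natz.
Qed.

(** Distinct nonnegative entries sum to at least 0 + 1 + ... + (m - 1), so [mu] has a repeated
    entry. *)
Lemma alt_delta_small mu nu : (forall i, 0 <= mu i) ->
  \sum_i mu i < \sum_i @staircase m i -> alt_delta mu nu = 0.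
Proof.
move=> mu0 lt; have [/injectiveP inj|/injectiveP] := boolP (injectiveb mu);
  last exact: alt_delta_ninj.
have [|q [le _]] := @injective_sort (fun i => `|mu i|%N).
  by move=> i j e; apply: inj; rewrite -(gez0_abs (mu0 i)) -(gez0_abs (mu0 j)) e.
suff : \sum_i @staircase m i <= \sum_i mu i by lia.
rewrite sum_staircase (reindex_inj (@perm_inj _ q)) /= -natz natr_sum.
by apply: ler_sum => i _; rewrite natz; have := le i; have := mu0 i; lia.
Qed.

(** With the minimal sum, either [mu] has a repetition and both sides vanish, or [mu] permutes the
    staircase and the first factor is the sign of that permutation. *)
Lemma alt_delta_staircase mu nu : (forall i, 0 <= mu i) ->
  \sum_i mu i = \sum_i @staircase m i ->
  alt_delta mu (@staircase m) * alt_delta nu (@staircase m) = alt_delta mu nu.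
Proof.
move=> mu0 es.
have [/injectiveP inj|/injectiveP ninj] := boolP (injectiveb mu); last first.
  by rewrite !(alt_delta_ninj _ ninj) mul0r.
have [|q [_ eq]] := @injective_sort (fun i => `|mu i|%N).
  by move=> i j e; apply: inj; rewrite -(gez0_abs (mu0 i)) -(gez0_abs (mu0 j)) e.
have {}eq : forall x, `|mu x|%N = q x.
  apply: eq; rewrite -lez_nat -sum_staircase -es -natz natr_sum.
  by apply: ler_sum => i _; rewrite natz; have := mu0 i; lia.
(* [mu] takes the value [q i] at [i]; the reversal turns this value into a position in the
   decreasing staircase. *)
pose u := (q * perm rev_ord_inj)%g : 'S_m.
have muE i : mu i = staircase (u i).
  rewrite /u permM permE /staircase /=.
  by have := eq i; have := mu0 i; have := ltn_ord (q i); lia.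
have -> : alt_delta mu (@staircase m) = (-1) ^+ u.
  rewrite -(alt_delta_perm u (@staircase_inj m)); exact: eq_alt_delta.
rewrite /alt_delta mulr_sumr (reindex_inj (mulIg u)) (reindex_inj invg_inj) /=.
apply: eq_bigr => w _; rewrite (odd_permM w^-1%g) (odd_permV w) mulrA -signr_addb addbC addbK.
congr (_ * (nat_of_bool _)%:R); apply/forallP/forallP => h x.
  by have := h (w x); rewrite permM permK muE => /eqP ->.
by have := h ((w^-1)%g x); rewrite permM permKV muE => /eqP ->.
Qed.

End AltDelta.

Section WeightSum.
Variables (T : finType) (N : nat).
Implicit Types (X : (T -> nat) -> int) (a : {ffun T -> 'I_N.+1}).

(** [N] bounds the values and stays fixed while [n] decreases in the recursion, so that all sums
    range over one finite type. *)
Definition weight_sum (n : nat) X : int :=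
  \sum_(a : {ffun T -> 'I_N.+1} | (\sum_t a t == n)%N) X (fun t => a t).

Lemma weight_sum_peel n X t k : (n <= N)%N -> (k < n)%N ->
  (forall f g, f =1 g -> X f = X g) ->
  \sum_(a : {ffun T -> 'I_N.+1} | (\sum_t a t == n)%N && (k < a t)%N) X (fun t => a t) =
  weight_sum (n - k.+1) (fun f => X (fun u => if u == t then f u + k.+1 else f u)%N).
Proof.
move=> nN kn eX; rewrite /weight_sum.
pose up a : {ffun T -> 'I_N.+1} := [ffun u => if u == t then inord (a u + k.+1) else a u].
pose dn a : {ffun T -> 'I_N.+1} := [ffun u => if u == t then inord (a u - k.+1) else a u].
have le_a a n' : (\sum_t a t == n')%N -> (a t <= n')%N.
  by move=> /eqP <-; rewrite (bigD1 t) //= leq_addr.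
have upE a : (\sum_t a t == n - k.+1)%N ->
    forall u, up a u = (if u == t then a u + k.+1 else a u)%N :> nat.
  move=> /le_a le u; rewrite ffunE; case: eqP => [->|//]; rewrite inordK //.
  by move: le kn nN; lia.
have dnE a u : dn a u = (if u == t then a u - k.+1 else a u)%N :> nat.
  rewrite ffunE; case: eqP => // _; rewrite inordK //.
  by have := ltn_ord (a u); lia.
rewrite (reindex_onto up dn) /=; last first.
  move=> a /andP[sa lt]; apply/ffunP => u; apply/val_inj => /=.
  rewrite upE; last first.
    rewrite -(eqP sa) (bigD1 t) //= [X in _ == (X - _)%N](bigD1 t) //= dnE eqxx.
    rewrite (eq_bigr (fun i => a i : nat)) => [|i ne]; last by rewrite dnE (negPf ne).
    by rewrite addnBAC.
  by rewrite dnE; case: eqP => [->|//]; rewrite subnK.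
have sum_up a : (\sum_t a t == n - k.+1)%N -> (\sum_t up a t == n)%N.
  move=> sa; rewrite (bigD1 t) //= upE // eqxx.
  rewrite (eq_bigr (fun i => a i : nat)) => [|i ne]; last by rewrite upE // (negPf ne).
  by move: sa; rewrite (bigD1 t) //=; move: (\sum_(_ | _) _)%N => s; lia.
apply: eq_big => [a|a].
  apply/idP/idP => [/andP[/andP[sa lt] /eqP e]|sa].
    rewrite -e (bigD1 t) //= dnE eqxx (eq_bigr (fun i => up a i : nat)).
      by move: sa lt; rewrite (bigD1 t) //=; move: (\sum_(_ | _) _)%N => s; lia.
    by move=> i ne; rewrite dnE (negPf ne).
  rewrite sum_up // upE // eqxx leq_addl /=.
  apply/eqP/ffunP => u; apply/val_inj => /=; rewrite dnE upE //.
  by case: eqP => //; rewrite addnK.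
move=> /andP[/andP[sa lt] /eqP e]; apply: eX => u; rewrite upE //.
rewrite -e (bigD1 t) //= dnE eqxx (eq_bigr (fun i => up a i : nat)).
  by move: sa lt; rewrite (bigD1 t) //=; move: (\sum_(_ | _) _)%N => s; lia.
by move=> i ne; rewrite dnE (negPf ne).
Qed.

(** Newton's relation n h_n = sum_k p_k h_(n-k): write [n] as the sum of the [a t], count [a t] as
    the number of [k < a t], and remove [k.+1] at [t]. *)
Lemma weight_sum_rec n X : (n <= N)%N -> (forall f g, f =1 g -> X f = X g) ->
  n%:Z * weight_sum n X =
  \sum_t \sum_(k < n) weight_sum (n - k.+1)
     (fun f => X (fun u => if u == t then f u + k.+1 else f u)%N).
Proof.
move=> nN eX.
transitivity (\sum_t \sum_(k < n) \sum_(a : {ffun T -> 'I_N.+1} |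
   (\sum_t a t == n)%N && (k < a t)%N) X (fun t => a t)); last first.
  by apply: eq_bigr => t _; apply: eq_bigr => k _; rewrite weight_sum_peel.
rewrite /weight_sum mulr_sumr.
under [RHS]eq_bigr => t _ do under eq_bigr => k _ do rewrite big_mkcondr.
under [RHS]eq_bigr => t _ do rewrite exchange_big.
rewrite [RHS]exchange_big /=; apply: eq_bigr => a sa.
rewrite -{1}(eqP sa) -natz natr_sum mulr_suml; apply: eq_bigr => t _.
rewrite -big_mkcond sumr_const mulr_natl; congr (_ *+ _).
have le : (a t <= n)%N by rewrite -(eqP sa) (bigD1 t) //= leq_addr.
by rewrite -sum1_card (big_ord_narrow le) /= sum1_card card_ord.
Qed.

End WeightSum.

Section AltNorm.
Variables (m : nat).
Implicit Types (mu nu : 'I_m -> int).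

Definition cell_product mu nu (f : 'I_m * 'I_m -> nat) : int :=
  alt_delta (fun i => mu i - \sum_j (f (i, j))%:Z) (@staircase m) *
  alt_delta (fun j => nu j - \sum_i (f (i, j))%:Z) (@staircase m).

Lemma eq_cell_product mu nu f g : f =1 g -> cell_product mu nu f = cell_product mu nu g.
Proof.
move=> e; congr (_ * _); apply: eq_alt_delta => // i; congr (_ - _).
  by apply: eq_bigr => j _; rewrite e.
by apply: eq_bigr => j _; rewrite e.
Qed.

Lemma cell_product_up mu nu i j k f :
  cell_product mu nu (fun u => if u == (i, j) then f u + k else f u)%N =
  cell_product (lower mu k i) (lower nu k j) f.
Proof.
congr (_ * _); apply: eq_alt_delta => // x; rewrite /lower.
  case: (eqVneq x i) => [->|ne].
    rewrite (bigD1 j) //= [X in _ = _ - X](bigD1 j) //= eqxx.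
    rewrite (eq_bigr (fun j => (f (i, j))%:Z)) => [|y ney]; first by rewrite PoszD; ring.
    by rewrite xpair_eqE (negPf ney) andbF.
  by congr (_ - _); apply: eq_bigr => y _; rewrite xpair_eqE (negPf ne).
case: (eqVneq x j) => [->|ne].
  rewrite (bigD1 i) //= [X in _ = _ - X](bigD1 i) //= eqxx.
  rewrite (eq_bigr (fun i => (f (i, j))%:Z)) => [|y ney]; first by rewrite PoszD; ring.
  by rewrite xpair_eqE (negPf ney).
by congr (_ - _); apply: eq_bigr => y _; rewrite xpair_eqE (negPf ne) andbF.
Qed.

Lemma sum_lower mu k i : \sum_j lower mu k i j = \sum_j mu j - k%:Z.
Proof.
rewrite (bigD1 i) //= [in RHS](bigD1 i) //= /lower eqxx.
rewrite (eq_bigr mu) => [|j ne]; last by rewrite (negPf ne).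
by rewrite addrAC.
Qed.

(** Cauchy's determinant: the left side is the coefficient of x^mu y^nu in the product of the two
    Vandermonde determinants and all 1 / (1 - x_i y_j), the right side that in det (1 / (1 - x_i
    y_j)). *)
Lemma weight_sum_cells N n mu nu : (n <= N)%N ->
  \sum_i mu i = n%:Z + \sum_i @staircase m i ->
  weight_sum N n (cell_product mu nu) =
  if [forall i, 0 <= mu i] then alt_delta mu nu else 0.
Proof.
elim/ltn_ind: n mu nu => n IH mu nu nN smu.
have [n0|n_gt0] := posnP n.
  have -> : weight_sum N n (cell_product mu nu) = cell_product mu nu (fun=> 0%N).
    rewrite /weight_sum (big_pred1 [ffun=> ord0]) => [|a].
      by apply: eq_cell_product => t; rewrite ffunE.
    rewrite n0 /= sum_nat_eq0; apply/forallP/eqP => [h|-> t]; last by rewrite ffunE.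
    by apply/ffunP => t; rewrite ffunE; apply/val_inj/eqP; have := h t.
  have -> : cell_product mu nu (fun=> 0%N) =
      alt_delta mu (@staircase m) * alt_delta nu (@staircase m).
    by congr (_ * _); apply: eq_alt_delta => // i; rewrite big1 ?subr0.
  case: ifP => [/forallP mu0|/negbT].
    by apply: alt_delta_staircase; rewrite // smu n0 add0r.
  rewrite negb_forall => /existsP[i ni]; rewrite [alt_delta mu _]big1 ?mul0r // => w _.
  case: forallP => [/(_ i)/eqP e|]; rewrite ?mulr0 //.
  by case/negP: ni; rewrite e.
apply: (mulfI (_ : n%:Z != 0)); first by rewrite eqz_nat -lt0n.
rewrite weight_sum_rec //; last exact: eq_cell_product.
pose G i k := if (k < n)%N && [forall x, 0 <= lower mu k.+1 i x] then
    \sum_j alt_delta (shift_boxes mu k.+1 i j) nu else 0.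
transitivity (\sum_i \sum_(k < n) G i k).
  rewrite -(pair_bigA _ (fun i j => \sum_(k < n) weight_sum N (n - k.+1)
     (fun f => cell_product mu nu (fun u => if u == (i, j) then f u + k.+1 else f u)%N))) /=.
  apply: eq_bigr => i _; rewrite exchange_big; apply: eq_bigr => k _ /=.
  rewrite /G ltn_ord /= -sum_lower_swap.
  rewrite (eq_bigr (fun j => if [forall x, 0 <= lower mu k.+1 i x] then
     alt_delta (lower mu k.+1 i) (lower nu k.+1 j) else 0)) => [|j _].
    by case: ifP => // _; rewrite big1.
  have -> : weight_sum N (n - k.+1) (fun f => cell_product mu nu
      (fun u => if u == (i, j) then f u + k.+1 else f u)%N) =
    weight_sum N (n - k.+1) (cell_product (lower mu k.+1 i) (lower nu k.+1 j)).
    by apply: eq_bigr => a _; rewrite cell_product_up.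
  have lk := ltn_ord k; apply: IH; try by lia.
  by rewrite sum_lower smu; lia.
case: ifP => [/forallP mu0|/negbT]; last first.
  (* A negative entry stays negative after lowering, so every term of the recursion is zero. *)
  rewrite negb_forall mulr0 => /existsP[x nx]; rewrite big1 // => i _; rewrite big1 // => k _.
  rewrite /G; case: forallP; rewrite ?andbF // => /(_ x) le.
  by case/negP: nx; apply: le_trans le _; rewrite /lower; case: eqP => // _; lia.
transitivity (\sum_i \sum_(k < `|mu i|) \sum_j alt_delta (shift_boxes mu k.+1 i j) nu).
  apply: eq_bigr => i _.
  have low x k : (0 <= lower mu k.+1 i x) = (x != i) || (k < `|mu i|)%N.
    have := mu0 x; rewrite /lower; case: eqP => [->|_] /=; lia.
  have lowE k : [forall x, 0 <= lower mu k.+1 i x] = (k < `|mu i|)%N.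
    apply/forallP/idP => [/(_ i)|h x]; first by rewrite low eqxx.
    by rewrite low h orbT.
  transitivity (\sum_(0 <= k < n | (k < `|mu i|)%N)
      \sum_j alt_delta (shift_boxes mu k.+1 i j) nu).
    rewrite big_mkord [RHS]big_mkcond; apply: eq_bigr => k _.
    by rewrite /G ltn_ord lowE.
  (* The bound [n] on [k] may be dropped: for [k >= n] the lowered vector sums to less than the
     staircase and [alt_delta_small] applies. *)
  rewrite sum_nat_cond_swap big_mkord big_mkcond; apply: eq_bigr => k _.
  case: ltnP => // le; rewrite -sum_lower_swap big1 // => j _.
  apply: alt_delta_small => [x|]; first by rewrite low ltn_ord orbT.
  by rewrite sum_lower smu; lia.
(* Moving boxes from [i] to [i] changes nothing, so the diagonal terms count [mu i] each; the
   off-diagonal ones subtract the staircase sum, leaving the factor [n]. *)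
under eq_bigr => i _ do rewrite exchange_big (bigD1 i) //=.
rewrite big_split /= alt_delta_offdiag //.
rewrite (eq_bigr (fun i => mu i * alt_delta mu nu)) => [|i _].
  by rewrite -mulr_suml smu mulrDl mulNr addrK.
rewrite (eq_bigr (fun=> alt_delta mu nu)) => [|k _].
  by rewrite sumr_const card_ord -mulr_natl natz gez0_abs.
by apply: eq_alt_delta => // x; rewrite /shift_boxes; case: eqP; lia.
Qed.

End AltNorm.

(** Two invariant colourings form one invariant colouring by pairs, whose contents are the row and
    column sums of its content matrix. *)
Lemma alt_charM n m (mu nu : 'I_m -> int) (g : 'S_n) :
  alt_char mu g * alt_char nu g =
  \sum_(h : {ffun 'I_n -> 'I_m * 'I_m} | [forall x, h (g x) == h x])
    cell_product mu nu (content_of h).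
Proof.
rewrite /alt_char big_distrlr pair_big /=.
pose unpair (h : {ffun 'I_n -> 'I_m * 'I_m}) : {ffun 'I_n -> 'I_m} * {ffun 'I_n -> 'I_m} :=
  ([ffun x => (h x).1], [ffun x => (h x).2]).
pose mkpair (p : {ffun 'I_n -> 'I_m} * {ffun 'I_n -> 'I_m}) : {ffun 'I_n -> 'I_m * 'I_m} :=
  [ffun x => (p.1 x, p.2 x)].
have unpairK : cancel unpair mkpair.
  by move=> h; apply/ffunP => x; rewrite !ffunE; case: (h x).
have mkpairK : cancel mkpair unpair.
  by move=> [f f']; congr (_, _); apply/ffunP => x; rewrite !ffunE.
rewrite (reindex unpair) /=; last exact/onW_bij/(Bijective unpairK mkpairK).
apply: eq_big => [h|h _].
  apply/andP/forallP => [[/forallP h1 /forallP h2] x|hx].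
    by have := h1 x; have := h2 x; rewrite !ffunE -pair_eqE /= /pair_eq => -> ->.
  by split; apply/forallP => x; rewrite !ffunE (eqP (hx x)).
have content1 i : content_of [ffun x => (h x).1] i = (\sum_j content_of h (i, j))%N.
  rewrite /content_of -sum1_card (partition_big (fun x => (h x).2) predT) //=.
  apply: eq_bigr => j _; rewrite -sum1_card; apply: eq_bigl => x.
  by rewrite !inE ffunE -pair_eqE.
have content2 j : content_of [ffun x => (h x).2] j = (\sum_i content_of h (i, j))%N.
  rewrite /content_of -sum1_card (partition_big (fun x => (h x).1) predT) //=.
  apply: eq_bigr => i _; rewrite -sum1_card; apply: eq_bigl => x.
  by rewrite !inE ffunE -pair_eqE /= /pair_eq andbC.
congr (_ * _); apply: eq_alt_delta => // i; congr (_ - _).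
  by rewrite content1 -natz natr_sum; apply: eq_bigr => j _; rewrite natz.
by rewrite content2 -natz natr_sum; apply: eq_bigr => j _; rewrite natz.
Qed.

Lemma sum_alt_char_sq n m (mu : 'I_m -> int) :
  injective mu -> (forall i, 0 <= mu i) ->
  \sum_i mu i = n%:Z + \sum_i @staircase m i ->
  \sum_(g : 'S_n) alt_char mu g * alt_char mu g = (n`!)%:Z.
Proof.
move=> mu_inj mu0 smu.
pose X (a : {ffun 'I_m * 'I_m -> 'I_n.+1}) := cell_product mu mu (fun t => a t).
transitivity (\sum_(g : 'S_n) \sum_(h : {ffun 'I_n -> 'I_m * 'I_m} |
    [forall x, h (g x) == h x]) X [ffun t => inord (content_of h t)]).
  apply: eq_bigr => g _; rewrite alt_charM; apply: eq_bigr => h _.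
  apply: eq_cell_product => t; rewrite ffunE inordK // ltnS.
  by rewrite -[X in (_ <= X)%N](content_of_sum h) (bigD1 t) //= leq_addr.
rewrite sum_fixed_colorings -/(weight_sum n n (cell_product mu mu)) weight_sum_cells //.
have -> : [forall i, 0 <= mu i] by apply/forallP.
by rewrite alt_delta_refl ?mulr1.
Qed.

(** * Frobenius' character formula *)

Section SpechtTrace.
Variables (n : nat) (lam : seq nat).
Hypothesis lam_young : is_young_diagram n lam.

Lemma sum_shifted_rows :
  \sum_i @shifted_rows lam i = n%:Z + \sum_i @staircase (size lam) i.
Proof.
rewrite -(young_sum lam_young) sumnE (big_nth 0%N) big_mkord -natz natr_sum -big_split /=.
by apply: eq_bigr => i _; rewrite natz.
Qed.

Lemma young_class_sumE (g : 'S_n) :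
  young_class_sum lam g = young_scalar n lam * alt_char (@shifted_rows lam) g.
Proof.
pose c := young_scalar n lam; pose om (g : 'S_n) := alt_char (@shifted_rows lam) g.
have om_sq : \sum_g om g * om g = (n`!)%:Z.
  by apply: sum_alt_char_sq; [apply: shifted_rows_inj lam_young | | apply: sum_shifted_rows].
have pair : \sum_g young_class_sum lam g * om g = (n`!)%:Z * c.
  rewrite sum_class_function ?sum_young_alt_char // => x h.
  exact: alt_char_class.
have sq0 : \sum_(g : 'S_n) (young_class_sum lam g - c * om g) ^+ 2 = 0.
  rewrite (eq_bigr (fun g => young_class_sum lam g * young_class_sum lam g
     - 2 * c * (young_class_sum lam g * om g) + c ^+ 2 * (om g * om g))); last first.
    by move=> h _; ring.
  rewrite big_split sumrB -!mulr_sumr sum_young_class_sq // pair om_sq -/c; rewrite /=; ring.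
have e := psumr_eq0P (fun h _ => sqr_ge0 _) sq0.
by apply/eqP; rewrite -subr_eq0 -sqrf_eq0 e.
Qed.

(** If c were zero, the class sum would vanish at the identity, where it equals n!. *)
Lemma young_scalar_neq0 : young_scalar n lam != 0.
Proof.
have := young_class_sum1 n lam; rewrite young_class_sumE.
by have := fact_gt0 n; case: eqP => [->|//]; rewrite mul0r; lia.
Qed.

Theorem specht_character (g : 'S_n) :
  \tr (specht_repr n lam g) = (alt_char (@shifted_rows lam) g)%:~R.
Proof.
have c0 : (young_scalar n lam)%:~R != 0 :> algC by rewrite intr_eq0 young_scalar_neq0.
by apply: (mulfI c0); rewrite specht_trace // young_class_sumE intrM.
Qed.

End SpechtTrace.

(** * Expansion over cycles *)

Section CycleSum.
Variable m : nat.
Implicit Types (mu : 'I_m -> int) (ks : seq nat).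

(** The coefficient of x^mu in the Vandermonde determinant times the power sums p_k for [k] in [ks]:
    each p_k chooses the variable that receives the exponent [k]. *)
Fixpoint cycle_sum mu ks : int :=
  if ks is k :: ks' then \sum_i cycle_sum (lower mu k i) ks'
  else alt_delta mu (@staircase m).

Lemma eq_cycle_sum mu mu' ks : mu =1 mu' -> cycle_sum mu ks = cycle_sum mu' ks.
Proof.
elim: ks mu mu' => [|k ks IH] mu mu' e /=; first exact: eq_alt_delta.
by apply: eq_bigr => i _; apply: IH => j; rewrite /lower e.
Qed.

Lemma cycle_sum_move mu k ks1 ks2 :
  cycle_sum mu (ks1 ++ k :: ks2) = cycle_sum mu (k :: ks1 ++ ks2).
Proof.
elim: ks1 mu => [|k1 ks1 IH] mu //=.
under eq_bigr => i _ do rewrite IH /=.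
rewrite exchange_big; apply: eq_bigr => i _; apply: eq_bigr => j _ /=.
by apply: eq_cycle_sum => x; rewrite /lower; case: eqP; case: eqP; lia.
Qed.

Lemma cycle_sum_perm mu ks1 ks2 : perm_eq ks1 ks2 -> cycle_sum mu ks1 = cycle_sum mu ks2.
Proof.
elim: ks1 mu ks2 => [|k ks1 IH] mu ks2 pe.
  by rewrite perm_sym in pe; rewrite (perm_nilP pe).
have : k \in ks2 by rewrite -(perm_mem pe) mem_head.
move=> kin; case/splitPr: kin pe => p1 p2 pe.
rewrite cycle_sum_move /=; apply: eq_bigr => i _; apply: IH.
move: pe; rewrite perm_sym -[p1 ++ k :: p2]/(p1 ++ [:: k] ++ p2).
by rewrite perm_catCA perm_cons perm_sym.
Qed.

Lemma cycle_sum_neg mu ks i : mu i < 0 -> cycle_sum mu ks = 0.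
Proof.
elim: ks mu => [|k ks IH] mu neg /=.
  rewrite /alt_delta big1 // => w _; case: forallP => [/(_ i)/eqP e|]; rewrite ?mulr0 //.
  by move: neg; rewrite e.
by rewrite big1 // => j _; apply: IH; rewrite /lower; case: eqP; lia.
Qed.

Lemma cycle_sum_tperm mu ks i j : i != j ->
  cycle_sum (mu \o tperm i j) ks = - cycle_sum mu ks.
Proof.
move=> ne; elim: ks mu => [|k ks IH] mu /=; first exact: alt_delta_tperm.
rewrite (reindex_inj (@perm_inj _ (tperm i j))) -sumrN; apply: eq_bigr => x _ /=.
rewrite -IH; apply: eq_cycle_sum => y; rewrite /lower /=.
by rewrite -{1}(tpermK i j y) (inj_eq perm_inj).
Qed.

Lemma cycle_sum_ninj mu ks : ~ injective mu -> cycle_sum mu ks = 0.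
Proof.
move=> ninj; case: (pickP (fun ij => (ij.1 != ij.2) && (mu ij.1 == mu ij.2))) => [[i j]|h].
  move=> /andP[/= ne /eqP e]; have := cycle_sum_tperm mu ks ne.
  rewrite (@eq_cycle_sum _ mu) => [|x /=]; first by lia.
  by case: tpermP => [->|->|].
case: ninj => i j e; apply/eqP/negPn/negP => ne.
by have := h (i, j); rewrite /= ne e eqxx.
Qed.

Lemma sum_labels_cycle_sum mu p (w : 'I_p -> nat) :
  \sum_(phi : {ffun 'I_p -> 'I_m})
     alt_delta (fun i => mu i - (\sum_(r | phi r == i) w r)%N%:Z) (@staircase m) =
  cycle_sum mu [seq w r | r <- enum 'I_p].
Proof.
elim: p mu w => [|p IH] mu w.
  have -> : enum 'I_0 = [::] by apply/size0nil; rewrite size_enum_ord.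
  have f0 : {ffun 'I_0 -> 'I_m} by apply: finfun; case.
  rewrite (big_pred1 f0) => [|f]; last by apply/esym/eqP/ffunP => -[].
  by apply: eq_alt_delta => // i; rewrite big_ord0 subr0.
rewrite enum_ordSl /= -map_comp.
under [RHS]eq_bigr => i _ do rewrite -IH.
rewrite [RHS]pair_big /=.
pose peel (f : {ffun 'I_p.+1 -> 'I_m}) := (f ord0, [ffun r => f (lift ord0 r)]).
pose glue (x : 'I_m * {ffun 'I_p -> 'I_m}) : {ffun 'I_p.+1 -> 'I_m} :=
  [ffun r => if unlift ord0 r is Some r' then x.2 r' else x.1].
have peelK : cancel peel glue.
  by move=> f; apply/ffunP => r; rewrite ffunE; case: unliftP => [j|] -> //=; rewrite ffunE.
have glueK : cancel glue peel.
  move=> [i f]; congr (_, _); first by rewrite ffunE unlift_none.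
  by apply/ffunP => r; rewrite !ffunE liftK.
rewrite [RHS](reindex peel) /=; last exact/onW_bij/(Bijective peelK glueK).
apply: eq_bigr => f _; apply: eq_alt_delta => // i.
rewrite big_mkcond big_ord_recl /= [in RHS]big_mkcond /lower [i == f _]eq_sym.
under [in RHS]eq_bigr => r _ do rewrite ffunE.
by case: eqP => _; rewrite ?add0n // PoszD opprD addrA.
Qed.

End CycleSum.

(** Colourings invariant under [s] are colourings of its cycles, and a cycle contributes its length
    to the content of its colour. *)
Lemma alt_char_cycle_sum n m (mu : 'I_m -> int) (s : 'S_n) :
  alt_char mu s = cycle_sum mu [seq #|pred_of_set C| | C <- enum (porbits s)].
Proof.
have cls (x : 'I_n) : porbit s x \in porbits s by apply: imset_f.
pose p := #|porbits s|.
have [rep repE] : exists rep : 'I_p -> 'I_n, forall r, porbit s (rep r) = enum_val r.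
  apply: (@fin_all_exists _ (fun=> 'I_n) (fun r x => porbit s x = enum_val r)) => r.
  have /imsetP[x _ e] := enum_valP r; by exists x.
pose rk (x : 'I_n) : 'I_p := enum_rank_in (cls x) (porbit s x).
have rkE x : enum_val (rk x) = porbit s x by rewrite enum_rankK_in.
have rk_rep r : rk (rep r) = r by apply: enum_val_inj; rewrite rkE repE.
have rk_s x : rk (s x) = rk x.
  by apply: enum_val_inj; rewrite !rkE; have := porbit_perm s 1 x; rewrite expg1.
have rk_eq f x : (forall y, f (s y) = f y) -> f (rep (rk x)) = f x :> 'I_m.
  move=> fs; have : rep (rk x) \in porbit s x by rewrite -eq_porbit_mem repE rkE.
  case/porbitP => i ->; elim: i => [|i IH]; first by rewrite expg0 perm1.
  by rewrite expgSr permM fs.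
have -> : [seq #|pred_of_set C| | C <- enum (porbits s)] =
    [seq #|pred_of_set (enum_val r)| | r <- enum 'I_p].
  have sz : size (enum 'I_p) = size (enum (porbits s)) by rewrite size_enum_ord -cardE.
  apply: (@eq_from_nth _ 0%N) => [|i]; rewrite size_map; first by rewrite size_map sz.
  move=> lt.
  have ip : (i < p)%N by rewrite /p cardE.
  rewrite (nth_map set0) // (nth_map (Ordinal ip)) ?sz //.
  by rewrite (nth_ord_enum (Ordinal ip) (Ordinal ip)) (enum_val_nth set0).
rewrite -sum_labels_cycle_sum /alt_char.
pose spread (phi : {ffun 'I_p -> 'I_m}) : {ffun 'I_n -> 'I_m} := [ffun x => phi (rk x)].
pose gather (f : {ffun 'I_n -> 'I_m}) : {ffun 'I_p -> 'I_m} := [ffun r => f (rep r)].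
rewrite (reindex_onto spread gather) /=; last first.
  move=> f /forallP fs; apply/ffunP => x; rewrite !ffunE rk_eq // => y.
  by apply/eqP.
apply: eq_big => [phi|phi _].
  apply/andP; split; first by apply/forallP => x; rewrite !ffunE rk_s.
  by apply/eqP/ffunP => r; rewrite !ffunE rk_rep.
apply: eq_alt_delta => // i; congr (_ - _%:Z); rewrite /content_of.
rewrite -sum1_card (partition_big rk (fun r => phi r == i)) /= => [|x]; last first.
  by rewrite inE ffunE.
apply: eq_bigr => r ri; rewrite -sum1_card; apply: eq_bigl => x.
rewrite inE ffunE -(inj_eq enum_val_inj) rkE -repE eq_porbit_mem.
apply/andP/idP => [[]//|xr]; split=> //.
by move: xr; rewrite -eq_porbit_mem repE -rkE (inj_eq enum_val_inj) => /eqP ->.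
Qed.

Lemma alt_char1 n m (mu : 'I_m -> int) :
  alt_char mu (1%g : 'S_n) = cycle_sum mu (nseq n 1%N).
Proof.
rewrite alt_char_cycle_sum; congr cycle_sum.
have orb x : porbit (1%g : 'S_n) x = [set x].
  apply/setP => y; rewrite inE; apply/porbitP/eqP => [[i ->]|->].
    by rewrite expg1n perm1.
  by exists 0%N; rewrite expg0 perm1.
have -> : nseq n 1%N =
    nseq (size [seq #|pred_of_set C| | C <- enum (porbits (1%g : 'S_n))]) 1%N.
  rewrite size_map -cardE card_imset ?card_ord // => x y.
  by rewrite !orb => /set1_inj.
apply/all_pred1P/allP => _ /mapP[C + ->]; rewrite mem_enum => /imsetP[x _ ->] /=.
by rewrite orb cards1.
Qed.

(** * Falling-factorial Vandermonde determinants *)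

Section FallingVandermonde.
Variable m : nat.
Implicit Types (mu : 'I_m -> int).

Definition falling (x : algC) (d : nat) : algC := \prod_(j < d) (x - j%:R).

Lemma falling_recl x d : falling x d.+1 = x * falling (x - 1) d.
Proof.
rewrite /falling big_ord_recl subr0; congr (_ * _); apply: eq_bigr => j _.
by rewrite /= /bump add1n -natr1; ring.
Qed.

Lemma falling_nat (a d : nat) : (d <= a)%N -> falling a%:R d * (a - d)`!%:R = a`!%:R.
Proof.
move=> le; rewrite -(ffact_fact le) natrM ffact_prod natr_prod; congr (_ * _).
by apply: eq_bigr => j _; rewrite natrB // (leq_trans _ le) // ltnW.
Qed.

Lemma falling_small (a d : nat) : (a < d)%N -> falling a%:R d = 0.
Proof. by move=> lt; rewrite /falling (bigD1 (Ordinal lt)) //= subrr mul0r. Qed.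

Definition falling_vdm mu : algC :=
  \sum_(s : 'S_m) (-1) ^+ s * \prod_i falling (mu i)%:~R (m - (s i).+1).

(* x (x-1)_d = (x-d) (x)_d, applied to one row of each term of the determinant. *)
Lemma falling_vdm_lower_sum mu :
  \sum_i (mu i)%:~R * falling_vdm (lower mu 1 i) =
  (\sum_i mu i - \sum_i @staircase m i)%:~R * falling_vdm mu.
Proof.
rewrite /falling_vdm; under eq_bigr do rewrite mulr_sumr.
rewrite exchange_big mulr_sumr; apply: eq_bigr => s _ /=.
rewrite [X in (_ - X)](reindex_inj (@perm_inj _ s)) /= -sumrB rmorph_sum mulr_suml /=.
apply: eq_bigr => i _; rewrite mulrCA [RHS]mulrCA; congr (_ * _).
rewrite (bigD1 i) // [in RHS](bigD1 i) //= !mulrA; congr (_ * _); last first.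
  by apply: eq_bigr => j ne; rewrite /lower (negPf ne).
rewrite /lower eqxx intrB -falling_recl /falling big_ord_recr /= mulrC.
by congr (_ * _); rewrite intrB.
Qed.

(** Falling factorials are monic of degree d, so their matrix is a unitriangular matrix times the
    Vandermonde one. The constant is a product of two signs, from reversing the exponents and from
    the order of the differences. *)
Lemma falling_vdmE : exists2 e : algC, e != 0 & forall mu,
  falling_vdm mu = e * \prod_(r < m) \prod_(t < m | (r < t)%N) ((mu r)%:~R - (mu t)%:~R).
Proof.
pose rv : 'S_m := perm rev_ord_inj.
pose sg : algC := \prod_(r < m) \prod_(t < m | (r < t)%N) (-1).
exists ((-1) ^+ rv * sg).
  rewrite mulf_neq0 ?signr_eq0 //; apply/prodf_neq0 => r _.
  by apply/prodf_neq0 => t _; rewrite oppr_eq0 oner_eq0.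
move=> mu; pose q d : {poly algC} := \prod_(j < d) ('X - j%:R%:P).
have szq d : size (q d) = d.+1 by rewrite size_prod_XsubC /index_enum -enumT size_enum_ord.
pose A := (\matrix_(d < m, i < m) falling (mu i)%:~R d).
pose L := (\matrix_(d < m, e < m) (q d)`_e).
pose V := Vandermonde m (\row_(i < m) (mu i)%:~R : 'rV[algC]_m).
have AE : A = L *m V.
  apply/matrixP => d i; rewrite !mxE.
  transitivity (q d).[(mu i)%:~R].
    by rewrite horner_prod; apply: eq_bigr => j _; rewrite hornerXsubC.
  rewrite (@horner_coef_wide _ m) ?szq //; apply: eq_bigr => e _.
  by rewrite !mxE.
have detL : \det L = 1.
  rewrite det_trig.
    rewrite big1 // => d _; rewrite mxE.
    have : q d \is monic by apply: monic_prod => j _; apply: monicXsubC.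
    by move/monicP; rewrite /lead_coef szq.
  apply/is_trig_mxP => d e lt; rewrite mxE nth_default // szq //.
have -> : falling_vdm mu = (-1) ^+ rv * \det A.
  rewrite -det_tr /falling_vdm /determinant mulr_sumr (reindex_inj (mulIg rv)) /=.
  apply: eq_bigr => s _; rewrite odd_permM signr_addb mulrA [(-1) ^+ rv * _]mulrC.
  congr (_ * _); apply: eq_bigr => i _; rewrite !mxE permM permE /=; congr falling.
  by have := ltn_ord (s i); lia.
rewrite AE det_mulmx detL mul1r det_Vandermonde -mulrA; congr (_ * _).
rewrite /sg -big_split; apply: eq_bigr => r _; rewrite -big_split; apply: eq_bigr => t _ /=.
by rewrite !mxE mulN1r opprB.
Qed.

Lemma falling_vdm_lower mu k i : injective mu ->
  falling_vdm (lower mu k i) = falling_vdm mu *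
    \prod_(j | j != i) (((mu i)%:~R - (mu j)%:~R - k%:R) / ((mu i)%:~R - (mu j)%:~R)).
Proof.
move=> mu_inj; have [e _ eE] := falling_vdmE; rewrite !eE -mulrA; congr (_ * _).
pose Q (r t : 'I_m) : algC := ((lower mu k i r)%:~R - (lower mu k i t)%:~R) /
                              ((mu r)%:~R - (mu t)%:~R).
have nz r t : r != t -> (mu r)%:~R - (mu t)%:~R != 0 :> algC.
  by move=> ne; rewrite -intrB intr_eq0 subr_eq0 (inj_eq mu_inj).
have -> : \prod_(r < m) \prod_(t < m | (r < t)%N)
    ((lower mu k i r)%:~R - (lower mu k i t)%:~R) =
  \prod_(r < m) \prod_(t < m | (r < t)%N) ((mu r)%:~R - (mu t)%:~R) *
  \prod_(r < m) \prod_(t < m | (r < t)%N) Q r t.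
  rewrite -big_split; apply: eq_bigr => r _; rewrite -big_split; apply: eq_bigr => t lt /=.
  by rewrite /Q mulrC divfK // nz // neq_ltn lt.
congr (_ * _); rewrite (@prod_lt_pairs _ _ i) => [|r t]; last first.
  by rewrite /Q -opprB -[in X in _ / X]opprB invrN mulrNN.
rewrite [X in _ * X]big1 ?mulr1 => [|r ne]; last first.
  rewrite big1 // => t /andP[lt ne']; rewrite /Q /lower (negPf ne) (negPf ne') divff //.
  by rewrite nz // neq_ltn lt.
apply: eq_bigr => j ne; rewrite /Q /lower (negPf ne) eqxx -opprB -[in X in _ / X]opprB.
by rewrite invrN mulrNN intrB; congr (_ / _); ring.
Qed.

(** A falling factorial of a natural number vanishes when its degree exceeds the number. With equal
    sums, the term of [s] survives only if [mu] equals the staircase permuted by [s], where the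
    quotient of factorials is 1. *)
Lemma falling_vdm_staircase mu : (forall i, 0 <= mu i) ->
  \sum_i mu i = \sum_i @staircase m i ->
  (alt_delta mu (@staircase m))%:~R = falling_vdm mu / \prod_i (`|mu i|%N)`!%:R.
Proof.
move=> mu0 smu; rewrite /alt_delta rmorph_sum mulr_suml; apply: eq_bigr => s _ /=.
have muE i : (mu i)%:~R = (`|mu i|%N)%:R :> algC by rewrite -{1}(gez0_abs (mu0 i)).
rewrite intrM rmorphXn rmorphN1 -mulrA; congr (_ * _).
have [/forallP h|] := boolP [forall i, mu i == staircase (s i)].
  rewrite -prodf_div big1 // => i _; rewrite muE (eqP (h i)) /staircase.
  have := falling_nat (leqnn (m - (s i).+1)); rewrite subnn mulr1 => ->.
  by rewrite divff // pnatr_eq0 -lt0n fact_gt0.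
rewrite negb_forall => /existsP[i ne].
have [j lt] : exists j, mu j < staircase (s j).
  case: (pickP (fun j => mu j < staircase (s j))) => [j lt|h]; first by exists j.
  have le j : staircase (s j) <= mu j by rewrite leNgt h.
  have : \sum_j staircase (s j) < \sum_j mu j.
    rewrite (bigD1 i) // [X in _ < X](bigD1 i) //= ltr_leD //.
      by rewrite lt_neqAle eq_sym ne le.
    by apply: ler_sum.
  by rewrite smu [X in _ < X](reindex_inj (@perm_inj _ s)) ltxx.
rewrite (bigD1 j) //= muE falling_small ?mul0r //.
by rewrite -ltz_nat gez0_abs.
Qed.

(** For the shifted rows of a diagram this is dimension / size!, the reciprocal of the product of
    the hook lengths. *)
Definition hook_weight mu : algC :=
  falling_vdm mu / \prod_i (`|mu i|%N)`!%:R.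

Lemma hook_weight_lower mu k i : injective mu -> (forall j, 0 <= mu j) -> k%:Z <= mu i ->
  hook_weight (lower mu k i) = strip_coef algC mu k i * hook_weight mu.
Proof.
move=> mu_inj mu0 le; have ki : (k <= `|mu i|)%N by lia.
have fact0 (a : nat) : a`!%:R != 0 :> algC by rewrite pnatr_eq0 -lt0n fact_gt0.
have muE : (mu i)%:~R = (`|mu i|%N)%:R :> algC by rewrite -{1}(gez0_abs (mu0 i)).
set f := falling (mu i)%:~R k.
have f0 : f != 0.
  by apply: contraNneq (fact0 `|mu i|%N) => e; rewrite -(falling_nat ki) -muE -/f e mul0r.
set g := \prod_j (`|lower mu k i j|%N)`!%:R : algC.
have g0 : g != 0 by apply/prodf_neq0 => j _; apply: fact0.
rewrite /hook_weight -/g.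
have -> : \prod_j (`|mu j|%N)`!%:R = f * g.
  rewrite /g (bigD1 i) //.
  rewrite (bigD1 i (P := predT) (F := fun j => (`|lower mu k i j|%N)`!%:R)) //= mulrA.
  congr (_ * _); last by apply: eq_bigr => j ne; rewrite /lower (negPf ne).
  rewrite /f muE -(falling_nat ki) /lower eqxx; congr (_ * _`!%:R); lia.
rewrite falling_vdm_lower // /strip_coef -/(falling _ _) -/f.
by field; rewrite f0 g0.
Qed.

End FallingVandermonde.

(** * Matching the two recursions *)

Section StripFormula.
Variable m : nat.
Implicit Types (mu : 'I_m -> int).

(** Frobenius' dimension formula, removing one box at a time; [falling_vdm_lower_sum] adds up the
    contributions to the factor [N.+1]. *)
Lemma cycle_sum_ones N mu : (forall i, 0 <= mu i) ->
  \sum_i mu i = N%:Z + \sum_i @staircase m i ->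
  (cycle_sum mu (nseq N 1%N))%:~R = N`!%:R * hook_weight mu.
Proof.
elim: N mu => [|N IH] mu mu0 smu.
  by rewrite mul1r /hook_weight -falling_vdm_staircase // smu add0r.
rewrite [cycle_sum _ _]/= rmorph_sum /=.
pose P := \prod_i (`|mu i|%N)`!%:R : algC.
transitivity (\sum_i N`!%:R / P * ((mu i)%:~R * falling_vdm (lower mu 1 i))).
  apply: eq_bigr => i _; have := mu0 i; rewrite le_eqVlt => /orP[/eqP e|pos].
    (* An entry 0 is lowered to -1 and contributes nothing on the left; on the right the factor
       [mu i] is zero. *)
    rewrite (@cycle_sum_neg _ _ _ i); last by rewrite /lower eqxx -e.
    by rewrite -e mul0r mulr0.
  rewrite IH; first last.
  - by rewrite sum_lower smu; lia.
  - by move=> j; have := mu0 j; rewrite /lower; case: eqP => [->|_]; lia.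
  rewrite /hook_weight -mulrA; congr (_ * _); rewrite mulrA mulrC; congr (_ * _).
  have fact0 (a : nat) : a`!%:R != 0 :> algC by rewrite pnatr_eq0 -lt0n fact_gt0.
  have mui : (mu i)%:~R != 0 :> algC by rewrite intr_eq0 gt_eqF.
  have -> : P = (mu i)%:~R * \prod_j (`|lower mu 1 i j|%N)`!%:R.
    rewrite /P (bigD1 i) //= [in RHS](bigD1 i) //= mulrA; congr (_ * _); last first.
      by apply: eq_bigr => j ne; rewrite /lower (negPf ne).
    rewrite /lower eqxx (_ : `|mu i - 1|%N = `|mu i|.-1); last by lia.
    have -> : `|mu i|`! = (`|mu i| * `|mu i|.-1`!)%N.
      have gt0 : (0 < `|mu i|)%N by lia.
      by rewrite -{1}(prednK gt0) factS prednK.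
    by rewrite natrM; congr (_ * _); rewrite -[in RHS](gez0_abs (mu0 i)).
  by rewrite invfM mulrAC mulVf // mul1r.
rewrite -mulr_sumr falling_vdm_lower_sum smu addrK.
have -> : N.+1%:Z%:~R = N.+1%:R :> algC by [].
by rewrite /hook_weight -/P factS natrM; ring.
Qed.

Lemma strip_coef_small mu k i : 0 <= mu i -> mu i < k%:Z -> strip_coef algC mu k i = 0.
Proof.
move=> mu0 lt; rewrite /strip_coef -/(falling _ _).
have -> : (mu i)%:~R = (`|mu i|%N)%:R :> algC by rewrite -{1}(gez0_abs mu0).
by rewrite falling_small ?mul0r //; lia.
Qed.

(** Last part first, so that [cycle_sum] removes the parts in the order of [strip_sum]. *)
Fixpoint part_list l : ('I_l -> nat) -> seq nat :=
  if l is l'.+1 return ('I_l -> nat) -> seq nat then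
    fun k => k ord_max :: part_list (fun r => k (lift ord_max r))
  else fun=> [::].

Lemma part_list_perm l (k : 'I_l -> nat) : perm_eq (part_list k) [seq k i | i <- enum 'I_l].
Proof.
elim: l k => [|l IH] k.
  by have -> : enum 'I_0 = [::] by apply/size0nil; rewrite size_enum_ord.
rewrite enum_ordSr map_rcons perm_sym perm_rcons perm_sym perm_cons.
apply: perm_trans (IH _) _; rewrite -map_comp.
rewrite (@eq_map _ _ _ (k \o widen_ord (leqnSn l))) // => r /=.
by congr k; apply/val_inj; rewrite /= /bump; have := ltn_ord r; lia.
Qed.

(** A term whose lowered entry is negative or repeated vanishes on both sides; otherwise
    [hook_weight_lower] converts the weight of the lowered vector. *)
Lemma cycle_sum_strip l N mu (k : 'I_l -> nat) : injective mu -> (forall i, 0 <= mu i) ->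
  \sum_i mu i = (N + \sum_r k r)%N%:Z + \sum_i @staircase m i ->
  (cycle_sum mu (part_list k ++ nseq N 1%N))%:~R =
  N`!%:R * strip_sum mu k * hook_weight mu.
Proof.
elim: l mu k => [|l IH] mu k mu_inj mu0 smu.
  by rewrite /= mulr1 cycle_sum_ones // smu big_ord0 addn0.
rewrite strip_sumS [cycle_sum _ _]/= rmorph_sum mulr_sumr mulr_suml /=.
apply: eq_bigr => i _; set k0 := k ord_max.
have [lt|le] := ltP (mu i) k0%:Z.
  rewrite strip_coef_small // (@cycle_sum_neg _ _ _ i) ?mul0r ?mulr0 ?mul0r //.
  by rewrite /lower eqxx; lia.
have [/injectiveP inj|/injectiveP ninj] := boolP (injectiveb (lower mu k0 i)); last first.
  by rewrite strip_coef_collision // cycle_sum_ninj // mul0r mulr0 mul0r.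
rewrite IH //; first by rewrite hook_weight_lower //; ring.
  by move=> j; have := mu0 j; rewrite /lower; case: eqP => [->|_]; lia.
by rewrite sum_lower smu (bigD1_ord ord_max) //= -/k0; lia.
Qed.

Lemma strip_sum_eq0 l mu (k : 'I_l -> nat) : injective mu -> (forall i, 0 <= mu i) ->
  \sum_i mu i < (\sum_r k r)%N%:Z + \sum_i @staircase m i -> strip_sum mu k = 0.
Proof.
elim: l mu k => [|l IH] mu k mu_inj mu0 smu.
  (* No vector with distinct nonnegative entries has so small a sum: [alt_delta mu mu] would be both
     0 and 1. *)
  have := alt_delta_small mu mu0; rewrite big_ord0 add0r in smu; move=> /(_ smu).
  by rewrite alt_delta_refl.
rewrite strip_sumS big1 // => i _; set k0 := k ord_max.
have [lt|le] := ltP (mu i) k0%:Z; first by rewrite strip_coef_small // mul0r.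
have [/injectiveP inj|/injectiveP ninj] := boolP (injectiveb (lower mu k0 i)); last first.
  by rewrite strip_coef_collision // mul0r.
rewrite IH ?mulr0 //.
  by move=> j; have := mu0 j; rewrite /lower; case: eqP => [->|_]; lia.
by rewrite sum_lower; move: smu; rewrite (bigD1_ord ord_max) //= -/k0; lia.
Qed.

End StripFormula.

(** In the quotient of [cycle_sum_strip] by [cycle_sum_ones] the weight cancels, and the falling
    factorial of [n] compensates the quotient of factorials. When the parts exceed [n],
    [strip_sum_eq0] matches the convention. *)
Lemma normalized_character_strip_sum n lam l (k : 'I_l -> nat) (s : 'S_n) :
  is_young_diagram n lam ->
  ((\sum_(r < l) k r <= n)%N -> has_cycle_type k s) ->
  normalized_character lam k s = strip_sum (@shifted_rows lam) k.
Proof.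
move=> yd hs; set mu := @shifted_rows lam.
have mu_inj : injective mu by apply: shifted_rows_inj yd.
have mu0 i : 0 <= mu i by [].
have smu := sum_shifted_rows yd; rewrite -/mu in smu.
rewrite /normalized_character; case: ltnP => [lt|le].
  by rewrite strip_sum_eq0 // smu ltrD2r ltz_nat.
rewrite !specht_character // -/mu alt_char1 alt_char_cycle_sum.
have one0 : (cycle_sum mu (nseq n 1%N))%:~R != 0 :> algC.
  rewrite intr_eq0 -alt_char1; have := young_class_sum1 n lam.
  rewrite young_class_sumE // -/mu; have := fact_gt0 n.
  by case: eqP => [->|//]; rewrite mulr0; lia.
set N := (n - \sum_(r < l) k r)%N.
have -> : cycle_sum mu [seq #|pred_of_set C| | C <- enum (porbits s)] =
    cycle_sum mu (part_list k ++ nseq N 1%N).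
  apply: cycle_sum_perm; apply: perm_trans (hs le) _.
  by rewrite perm_cat2r perm_sym part_list_perm.
have nE : n = (N + \sum_r k r)%N by rewrite subnK.
rewrite cycle_sum_strip -?nE // mulrAC; apply: (mulIf one0); rewrite divfK //.
rewrite cycle_sum_ones // -(ffact_fact le) -/N natrM; ring.
Qed.

Theorem theorem5 (n : nat) (lam : seq nat) (l : nat) (k : 'I_l -> nat)
    (s : 'S_n) :
  is_young_diagram n lam ->
  (0 < l)%N ->
  (forall r, (0 < k r)%N) ->
  ((\sum_(r < l) k r <= n)%N -> has_cycle_type k s) ->
  (-1) ^+ l * (\prod_(r < l) (k r)%:R) * normalized_character lam k s =
  iter_residue
    ((\prod_(r < l) \prod_(i < k r) cauchyH lam (zvar r - i%:R)) *
     \prod_(r < l) \prod_(t < l | (r < t)%N)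
       ((zvar r - zvar t) * (zvar r - zvar t + (k t)%:R - (k r)%:R) /
        ((zvar r - zvar t - (k r)%:R) * (zvar r - zvar t + (k t)%:R)))).
Proof.
move=> yd _ k_gt0 hs; rewrite (normalized_character_strip_sum yd hs).
(* All variables are shifted by [size lam], the translation from contents to shifted rows; the pair
   factors depend only on differences and are unaffected. *)
rewrite -(iter_residue_full_product (fun=> (size lam)%:Z) (shifted_rows_inj yd) k_gt0).
congr iter_residue; rewrite /full_product; congr (_ * _); apply: eq_bigr => r _.
  by rewrite (prod_cauchyH yd) // => x; apply: zvar_neq_int.
apply: eq_bigr => t _; rewrite /pair_factor.
by rewrite opprD addrACA subrr addr0.
Qed.
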